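(* Let $\ell\ge2$ be an integer and let $q$ be a positive integer with $\log q\ge e^{30\ell^2}$. Let $\chi$ be a non-principal real Dirichlet character modulo $q$ and suppose that $L(s,\chi)$ has an exceptional zero $\beta_0$. Then $$\beta_0\le 1-\frac{3200\,\pi\left(\frac{\ell}{\ell+1}\right)^2}{\sqrt q\,\log^2 q}.$$
   Context: $L(s,\chi)=\sum_{n\ge1}\chi(n)n^{-s}$ is the Dirichlet $L$-function of $\chi$. An exceptional zero of $L(s,\chi)$ is a real number $\beta_0$ with $L(\beta_0,\chi)=0$ and $1-\beta_0\ll 1/\log q$, i.e. $1-\beta_0\le C/\log q$ for a fixed absolute constant $C>0$ (the value of $C$ is not specified). $\log$ is the natural logarithm. *)

(* Defs.v *)
From HB Require Import structures.
From mathcomp Require Import all_boot all_order all_algebra.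
From mathcomp Require Import all_classical all_reals all_analysis.
From mathcomp Require Import complex.

Set Implicit Arguments.
Unset Strict Implicit.
Unset Printing Implicit Defensive.

Import Order.TTheory GRing.Theory Num.Theory.
Import numFieldNormedType.Exports.

Local Open Scope ring_scope.
Local Open Scope complex_scope.
Local Open Scope classical_set_scope.

Definition dirichlet_character (R : realType) (q : nat) (chi : int -> R[i]) :
    Prop :=
  [/\ forall m, chi (m + q%:Z) = chi m,
      forall m n, chi (m * n) = chi m * chi n &
      forall m, chi m != 0 <-> coprimez m q].

Definition principal_character (R : realType) (q : nat) (m : int) : R[i] :=
  (coprimez m q)%:R.

Definition real_character (R : realType) (chi : int -> R[i]) : Prop :=
  forall m, chi m \is Num.real.

Definition cexp (R : realType) (z : R[i]) : R[i] :=
  (expR (complex.Re z))%:C * (cos (complex.Im z) +i* sin (complex.Im z)).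

(* n ^ (- s), for n >= 1 *)
Definition cpow_opp (R : realType) (n : nat) (s : R[i]) : R[i] :=
  cexp (- (s * (ln n%:R)%:C)).

(* The sum of the series in increasing order of n; R[i]^o is R[i] with the
   topology given by its norm.  For a non-principal character the series
   converges, conditionally when 0 < Re s <= 1, exactly on Re s > 0.  Where it
   diverges the library's [limn] returns the default point 0 of R[i], which is
   not the value of the analytic continuation. *)
Definition dirichlet_L (R : realType) (chi : int -> R[i]) (s : R[i]) : R[i] :=
  limn (fun N : nat =>
    \sum_(1 <= n < N.+1) chi n%:Z * cpow_opp n s : R[i]^o).

(* C is the implied constant in 1 - beta << 1 / log q. *)
Definition exceptional_zero (R : realType) (C : R) (q : nat)
    (chi : int -> R[i]) (beta : R) : Prop :=
  dirichlet_L chi beta%:C = 0 /\ 1 - beta <= C / ln q%:R.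

(* Main.v *)
Require Import Defs.
From HB Require Import structures.
From mathcomp Require Import all_boot all_order all_algebra.
From mathcomp Require Import all_classical all_reals all_analysis.
From mathcomp Require Import complex.
From mathcomp Require Import cyclic.
From mathcomp Require Import ring lra zify.

Set Implicit Arguments.
Unset Strict Implicit.
Unset Printing Implicit Defensive.

Import Order.TTheory GRing.Theory Num.Theory.
Import numFieldNormedType.Exports.

Local Open Scope ring_scope.

(* Write c(n) = Re chi(n), r(n) = sum_(d | n) c(d) and delta = 1 - beta, where
   L(beta) = 0.  Since r >= 0 and r is the coefficient of zeta * L, the
   vanishing of L at beta gives
     L(1) X^delta / delta ~ sum_(n <= X) r(n) n^(-beta)
   for X polynomial in q (this also excludes beta > 1).  The theorem then
   follows from 1 - beta >> 1 / (sqrt q log q), as log q is enormous, i.e. from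
     sum_(n <= X) r(n) / n << sqrt q log q L(1).
   This rests on two facts.
   - For y >= 64 q, sum_(y < n <= 4y) r(n) <= 80 y L(1).  With the weights
     e^(-nh) - e^(-2nh), h = 1 / (4y), the sum is L(1) / (2h) up to a sum of
     c(d) against a convex sequence.  Two summations by parts bound that error by
     the sup norm of the second antidifference of c, which is O(q^(3/2)) by
     Fourier analysis modulo q; the Fourier coefficients at a are at most
     sqrt (q a) in size, whether or not the character is primitive.
   - r(n j^2) >= r(n), so that every n <= 4y in a given square class forces many
     values of r in ]y, 4y]; this bounds sum_(n <= 4y) r(n) / n by
     O(log y / sqrt y) times the preceding sum.
   Since r is at least 1 at squares, the first fact also yields L(1) > 0. *)

(** * Divisor sums of a real character *)

Section DivisorSums.
Variables (R : rcfType) (c : nat -> R).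

Definition divsum (n : nat) : R := \sum_(d <- divisors n) c d.

Hypothesis cM : forall m n, c (m * n)%N = c m * c n.
Hypothesis c1 : c 1%N = 1.
Hypothesis c01 : forall n, [\/ c n = 0, c n = 1 | c n = -1].

Lemma divsum1 : divsum 1 = 1.
Proof. by rewrite /divsum (_ : divisors 1 = [:: 1%N]) // big_seq1. Qed.

(** The divisors of p n are the multiples p e with e | n and those prime to p, which are the
    divisors of the p'-part of n. *)
Lemma divsum_primeM p n : prime p -> (0 < n)%N ->
  divsum (p * n) = c p * divsum n + divsum n`_p^'.
Proof.
move=> pp n0; have p0 := prime_gt0 pp.
have pn0 : (0 < p * n)%N by rewrite muln_gt0 p0.
have p'0 : (0 < n`_p^')%N by apply: part_gt0.
have cop : coprime p n`_p^'.
  by rewrite prime_coprime // -p'natE //; apply: part_pnat.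
have -> : divsum (p * n) =
    \sum_(d <- [seq (p * e)%N | e <- divisors n] ++ divisors n`_p^') c d.
  apply: perm_big; apply: uniq_perm; first exact: divisors_uniq.
  - rewrite cat_uniq map_inj_uniq ?divisors_uniq /= ?andbT; last first.
      by move=> a b /eqP; rewrite eqn_pmul2l // => /eqP.
    apply/hasPn => d; rewrite -dvdn_divisors // => dn.
    apply/mapP => -[e _ de]; move: (coprime_dvdr dn cop).
    by rewrite de prime_coprime // dvdn_mulr.
  - move=> d; rewrite mem_cat -!dvdn_divisors //.
    have [pd|pd] := boolP (p %| d)%N.
      have [e de] := dvdnP pd.
      have -> : (d \in [seq (p * e)%N | e <- divisors n]) = (e %| n)%N.
        apply/mapP/idP => [[e' He']|en].
          move/eqP; rewrite de mulnC eqn_pmul2l // => /eqP ->.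
          by move: He'; rewrite -dvdn_divisors.
        by exists e; [rewrite -dvdn_divisors | rewrite de mulnC].
      rewrite de mulnC dvdn_pmul2l //.
      case: (boolP (_ %| _)%N) => //= _; apply/esym/negP => h.
      move: cop; rewrite prime_coprime // => /negP; apply.
      exact: dvdn_trans (dvdn_mulr e (dvdnn p)) h.
    have -> : (d \in [seq (p * e)%N | e <- divisors n]) = false.
      by apply/mapP => -[e _ de]; rewrite de dvdn_mulr in pd.
    have cpd : coprime d p by rewrite coprime_sym prime_coprime.
    rewrite Gauss_dvdr //= -{1}(partnC p n0) Gauss_dvdr // p_part.
    by rewrite coprimeXr.
rewrite big_cat big_map /=; congr (_ + _).
by rewrite /divsum mulr_sumr; apply: eq_bigr => e _; rewrite cM.
Qed.

(** Induction on [k]: the p'-part of p^j n stays n, so each step is one Horner step of the geometric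
    sum. *)
Lemma divsum_pfactorM p k n : prime p -> (0 < n)%N -> ~~ (p %| n)%N ->
  divsum (p ^ k * n) = (\sum_(i < k.+1) c p ^+ i) * divsum n.
Proof.
move=> pp n0 pn.
have p'k j : ((p ^ j * n)`_p^')%N = n.
  have pj : (0 < p ^ j)%N by rewrite expn_gt0 prime_gt0.
  rewrite partnM // [X in (X * _)%N]part_p'nat ?pnatNK ?pnatX ?pnat_id //.
  by rewrite mul1n part_pnat_id // p'natE.
elim: k => [|k IH]; first by rewrite expn0 mul1n big_ord1 expr0 mul1r.
rewrite expnS -mulnA divsum_primeM //; last first.
  by rewrite muln_gt0 expn_gt0 prime_gt0.
rewrite IH p'k.
rewrite mulrA -{2}[divsum n]mul1r -mulrDl; congr (_ * _).
rewrite [RHS]big_ord_recl expr0 addrC; congr (_ + _).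
by rewrite mulr_sumr; apply: eq_bigr => i _; rewrite lift0 exprS.
Qed.

Lemma divsum_part p n : prime p -> (0 < n)%N ->
  divsum n = (\sum_(i < (logn p n).+1) c p ^+ i) * divsum n`_p^'.
Proof.
move=> pp n0; rewrite -[in LHS](partnC p n0) p_part divsum_pfactorM //.
by rewrite -p'natE // part_pnat.
Qed.

(** Two terms are removed at a time: x^k + x^(k+1) >= 0 for x in {0, 1, -1}. *)
Lemma geomsum_char_ge0 p k : 0 <= \sum_(i < k) c p ^+ i.
Proof.
elim/ltn_ind: k => -[|[|k]] IH; first by rewrite big_ord0.
  by rewrite big_ord1 expr0.
rewrite !big_ord_recr /= -addrA addr_ge0 ?IH //.
case: (c01 p) => ->; first by case: k {IH} => [|k]; rewrite ?expr0 ?expr0n /=; lra.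
  by rewrite !expr1n; lra.
by rewrite exprS; lra.
Qed.

(** Stripping off the smallest prime factor leaves a geometric sum times the same quantity at a
    smaller argument. *)
Lemma divsum_ge0 n : (0 < n)%N -> 0 <= divsum n.
Proof.
elim/ltn_ind: n => n IH n0.
have [->|n1] := eqVneq n 1%N; first by rewrite divsum1.
have {}n1 : (1 < n)%N by rewrite ltn_neqAle eq_sym n1.
have pp := pdiv_prime n1.
rewrite (divsum_part pp) // mulr_ge0 ?geomsum_char_ge0 // IH ?part_gt0 //.
rewrite -[ltnRHS](partnC (pdiv n) n0) ltn_Pmull ?part_gt0 //.
by rewrite p_part -[ltnLHS](expn0 (pdiv n)) ltn_exp2l ?prime_gt1 // logn_gt0
  mem_primes pp n0 pdiv_dvd.
Qed.

(** The exponent of [p] grows by 2, so the geometric factor gains x^(k+1) + x^(k+2) with x = [c p]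
    and k = [logn p n], which is 0 or 2. *)
Lemma divsum_mul_prime_sqr p n : prime p -> (0 < n)%N ->
  divsum n <= divsum (n * p ^ 2).
Proof.
move=> pp n0; have p0 := prime_gt0 pp.
have np0 : (0 < n * p ^ 2)%N by rewrite muln_gt0 n0 expn_gt0 p0.
rewrite (divsum_part pp n0) (divsum_part pp np0).
rewrite lognM ?expn_gt0 ?p0 // pfactorK //.
rewrite partnM ?expn_gt0 ?p0 // [X in _ * divsum (_ * X)](_ : _ = 1%N); last first.
  by apply: part_p'nat; rewrite pnatNK pnatX pnat_id.
rewrite muln1 ler_wpM2r ?divsum_ge0 ?part_gt0 //.
rewrite addn2 [leRHS]big_ord_recr [X in _ <= X + _]big_ord_recr /= -addrA lerDl.
case: (c01 p) => ->; first by rewrite !exprS !mul0r addr0.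
  by rewrite !expr1n; lra.
by rewrite [X in _ + X]exprS mulN1r subrr.
Qed.

Lemma divsum_mul_sqr n j : (0 < n)%N -> (0 < j)%N ->
  divsum n <= divsum (n * j ^ 2).
Proof.
move=> n0; elim/ltn_ind: j => j IH j0.
have [->|j1] := eqVneq j 1%N; first by rewrite exp1n muln1.
have {}j1 : (1 < j)%N by rewrite ltn_neqAle eq_sym j1.
have pp := pdiv_prime j1.
have [i ij] := dvdnP (pdiv_dvd j).
have i0 : (0 < i)%N by move: j0; rewrite ij muln_gt0 => /andP[].
apply: (le_trans (IH i _ i0)); first by rewrite [ltnRHS]ij ltn_Pmulr // prime_gt1.
rewrite [in leRHS]ij expnMn mulnA; apply: divsum_mul_prime_sqr => //.
by rewrite muln_gt0 n0 expn_gt0 i0.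
Qed.

Lemma sum_multiples (F : nat -> R) d N : (0 < d)%N ->
  \sum_(1 <= n < N.+1 | (d %| n)%N) F n =
  \sum_(1 <= m < (N %/ d).+1) F (d * m)%N.
Proof.
move=> d0; elim: N => [|N IH]; first by rewrite div0n !big_geq.
rewrite big_mkcond big_nat_recr //= -big_mkcond IH divnS //.
case: ifP => dN; last by rewrite add0n addr0.
rewrite add1n [in RHS]big_nat_recr //=; congr (_ + F _).
have := divnK dN; rewrite divnS // dN add1n => <-; exact: mulnC.
Qed.
End DivisorSums.

(** * Square classes *)

Section SquareClasses.

Lemma sqf_exists (n : nat) : (0 < n)%N ->
  exists a, [exists m : 'I_n.+1, n == (a * m ^ 2)%N].
Proof.
move=> n0; exists n; apply/existsP; exists (inord 1).
by rewrite inordK ?ltnS // exp1n muln1.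
Qed.

(* Minimality of [a] stands for its being squarefree. *)
Definition sqfree_part (n : nat) : nat :=
  if (0 < n)%N =P true is ReflectT n0 then ex_minn (sqf_exists n0) else 0.

Lemma sqfree_partP n : (0 < n)%N ->
  (exists m, n = sqfree_part n * m ^ 2)%N.
Proof.
move=> n0; rewrite /sqfree_part; case: eqP => // n0'.
by case: ex_minnP => a /existsP[m /eqP nE] _; exists m.
Qed.

Lemma sqfree_part_min n a m : (0 < n)%N -> n = (a * m ^ 2)%N ->
  (sqfree_part n <= a)%N.
Proof.
move=> n0 nE; rewrite /sqfree_part; case: eqP => // n0'.
case: ex_minnP => b _; apply; apply/existsP.
have [a0 m0] : (0 < a)%N /\ (0 < m)%N.
  by move: n0; rewrite nE muln_gt0 expn_gt0 orbF => /andP.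
have mn : (m < n.+1)%N.
  rewrite ltnS nE; apply: leq_trans (leq_pmull _ a0).
  by rewrite expnS expn1 leq_pmull.
by exists (Ordinal mn); rewrite /= -nE.
Qed.

(** One inequality is minimality. For the other, cancel g = gcd(m, j) in n j^2 = a m^2: then j1^2 is
    coprime to m1^2, hence divides [a], and a / j1^2 represents the square class of [n]. *)
Lemma sqfree_part_mul_sqr n j : (0 < n)%N -> (0 < j)%N ->
  sqfree_part (n * j ^ 2) = sqfree_part n.
Proof.
move=> n0 j0; have nj0 : (0 < n * j ^ 2)%N by rewrite muln_gt0 n0 expn_gt0 j0.
apply/eqP; rewrite eqn_leq; apply/andP; split.
  have [m nE] := sqfree_partP n0.
  by apply: (@sqfree_part_min _ _ (m * j)) => //; rewrite expnMn mulnA -nE.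
have [m E] := sqfree_partP nj0; set a := sqfree_part _ in E *.
have [a0 m0] : (0 < a)%N /\ (0 < m)%N.
  by move: nj0; rewrite E muln_gt0 [X in _ && X]expn_gt0 orbF => /andP.
set g := gcdn m j; have g0 : (0 < g)%N by rewrite gcdn_gt0 m0.
have [m1 mE] := dvdnP (dvdn_gcdl m j); have [j1 jE] := dvdnP (dvdn_gcdr m j).
rewrite -/g in mE jE.
have j10 : (0 < j1)%N by move: j0; rewrite jE muln_gt0 => /andP[].
have cop : coprime (j1 ^ 2) (m1 ^ 2).
  rewrite coprimeXl // coprimeXr // /coprime -(eqn_pmul2r g0) mul1n.
  by rewrite muln_gcdl -mE -jE gcdnC.
have E1 : (n * j1 ^ 2 = a * m1 ^ 2)%N.
  apply/eqP; rewrite -(@eqn_pmul2r (g ^ 2)) ?expn_gt0 ?g0 //.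
  by rewrite -(mulnA n) -(mulnA a) -!expnMn -mE -jE E.
have /dvdnP[b ab] : (j1 ^ 2 %| a)%N.
  by rewrite -(Gauss_dvdl _ cop) -E1 dvdn_mull.
have nb : n = (b * m1 ^ 2)%N.
  apply/eqP; rewrite -(@eqn_pmul2r (j1 ^ 2)) ?expn_gt0 ?j10 //.
  by rewrite E1 ab mulnAC.
apply: leq_trans (sqfree_part_min n0 nb) _.
by rewrite ab leq_pmulr // expn_gt0 j10.
Qed.

End SquareClasses.

(** * Logarithmic sums over square classes *)

Section SquareClassSum.
Variable R : rcfType.
Implicit Types f : nat -> R.

Lemma sqrtr_le (a b : R) : 0 <= b -> a <= b ^+ 2 -> Num.sqrt a <= b.
Proof. by move=> b0 /ler_wsqrtr; rewrite sqrtr_sqr ger0_norm. Qed.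

Lemma ler_sum_subset (s r : seq nat) f : uniq s -> uniq r ->
  {subset s <= r} -> {in r, forall k, 0 <= f k} ->
  \sum_(k <- s) f k <= \sum_(k <- r) f k.
Proof.
move=> us ur sr f0; rewrite [leRHS](bigID (mem s)) /=.
rewrite [X in _ <= X + _](_ : _ = \sum_(k <- s) f k).
  by rewrite lerDl big_seq_cond sumr_ge0 // => k /andP[/f0].
rewrite -big_filter; apply: perm_big; apply: uniq_perm => [||k] //.
  exact: filter_uniq.
by rewrite mem_filter; case: (boolP (k \in s)) => //= /sr ->.
Qed.

Lemma sqfree_part_gt0 n : (0 < n)%N -> (0 < sqfree_part n)%N.
Proof.
move=> n0; have [m E] := sqfree_partP n0.
by move: n0; rewrite {1}E muln_gt0 => /andP[].
Qed.

(* All the [n j^2] lie in the square class of [n]. *)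
Lemma dyadic_class_ge f (n y : nat) : (0 < n)%N -> (n <= 4 * y)%N ->
  (forall k, (0 < k)%N -> 0 <= f k) ->
  (forall k j, (0 < k)%N -> (0 < j)%N -> f k <= f (k * j ^ 2)%N) ->
  f n * (Num.sqrt y%:R / (2 * Num.sqrt n%:R)) <=
  \sum_(y.+1 <= k < (4 * y).+1 | sqfree_part k == sqfree_part n) f k.
Proof.
move=> n0 ny f0 fM.
(* [t] will be the largest integer with n t^2 <= 4y; the multipliers used are the j in ]t/2, t]. *)
have exP : exists t, (n * t ^ 2 <= 4 * y)%N by exists 1%N; rewrite muln1.
have bnd t : (n * t ^ 2 <= 4 * y)%N -> (t <= 4 * y)%N by nia.
case: (ex_maxnP exP bnd) => t tP tmax.
have t1 : (1 <= t)%N by apply: tmax; rewrite muln1.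
have tS : (4 * y < n * t.+1 ^ 2)%N.
  by rewrite ltnNge; apply/negP => /tmax; rewrite ltnn.
have sn0 : 0 < Num.sqrt (n%:R : R) by rewrite sqrtr_gt0 ltr0n.
(* Maximality gives 4y < n (t+1)^2, and ]t/2, t] contains at least (t+1)/4 integers. *)
have half : Num.sqrt (y%:R : R) / (2 * Num.sqrt n%:R) <= (t - t./2)%:R.
  have h1 : Num.sqrt (y%:R : R) <= Num.sqrt n%:R * (t.+1%:R / 2).
    apply: sqrtr_le; first by rewrite mulr_ge0 ?sqrtr_ge0 // divr_ge0.
    rewrite exprMn sqr_sqrtr // expr_div_n mulrA ler_pdivlMr ?exprn_gt0 //.
    by rewrite -!natrX -!natrM ler_nat mulnC ltnW.
  rewrite ler_pdivrMr ?mulr_gt0 //; apply: le_trans h1 _.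
  have : t.+1%:R / 2 <= (t - t./2)%:R * 2 :> R.
    by rewrite ler_pdivrMr // -!natrM ler_nat; lia.
  by move=> h; rewrite [leRHS]mulrA [leRHS]mulrC ler_wpM2l // ltW.
apply: (@le_trans _ _ (\sum_((t./2).+1 <= j < t.+1) f (n * j ^ 2)%N)).
  apply: (@le_trans _ _ (\sum_((t./2).+1 <= j < t.+1) f n)).
    by rewrite sumr_const_nat subSS -[leRHS]mulr_natr ler_wpM2l ?f0.
  rewrite big_nat_cond [leRHS]big_nat_cond; apply: ler_sum => j /andP[/andP[j0 _] _].
  by apply: fM => //; apply: leq_trans j0.
rewrite -(big_map (fun j => n * j ^ 2)%N xpredT f) -[leRHS]big_filter.
apply: ler_sum_subset.
- by rewrite map_inj_uniq ?iota_uniq // => i j /eqP;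
  rewrite eqn_pmul2l // eqn_exp2r // => /eqP.
- by rewrite filter_uniq // iota_uniq.
- move=> k /mapP[j]; rewrite mem_index_iota => /andP[j1 j2] ->.
  rewrite mem_filter sqfree_part_mul_sqr ?eqxx //=; last by lia.
  rewrite mem_index_iota ltnS; apply/andP; split.
    (* From 2j >= t+1 follows 4 n j^2 >= n (t+1)^2 > 4y, so n j^2 lies above y. *)
    rewrite -(@ltn_pmul2l 4) //; apply: leq_trans tS _.
    rewrite [leqRHS]mulnCA leq_pmul2l // (_ : 4 = 2 ^ 2)%N // -expnMn leq_sqr; lia.
  by apply: leq_trans tP; rewrite leq_pmul2l // leq_sqr.
- by move=> k; rewrite mem_filter mem_index_iota => /and3P[_ k0 _]; rewrite f0 //; lia.
Qed.

(** Members of the class are a m^2 with distinct m <= N, and 1 / sqrt(a m^2) <= 1 / m since a >=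
    1. *)
Lemma square_class_sum_le a N : (0 < a)%N ->
  \sum_(1 <= n < N.+1 | sqfree_part n == a) (Num.sqrt n%:R)^-1 <=
  \sum_(1 <= m < N.+1) (m%:R : R)^-1.
Proof.
move=> a0.
apply: (@le_trans _ _ (\sum_(1 <= m < N.+1) (Num.sqrt ((a * m ^ 2)%:R : R))^-1)).
  rewrite -(big_map (fun m => a * m ^ 2)%N xpredT (fun n => (Num.sqrt (n%:R : R))^-1)).
  rewrite -[leLHS]big_filter; apply: ler_sum_subset.
  - by rewrite filter_uniq // iota_uniq.
  - by rewrite map_inj_uniq ?iota_uniq // => i j /eqP;
    rewrite eqn_pmul2l // eqn_exp2r // => /eqP.
  - move=> n; rewrite mem_filter mem_index_iota => /andP[/eqP an /andP[n1 n2]].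
    have [m] := sqfree_partP n1; rewrite an => E; apply/mapP; exists m => //.
    rewrite mem_index_iota; nia.
  - by move=> n _; rewrite invr_ge0 sqrtr_ge0.
rewrite big_nat_cond [leRHS]big_nat_cond; apply: ler_sum => m /andP[/andP[m0 _] _].
rewrite lef_pV2 ?posrE ?ltr0n ?sqrtr_gt0 ?ltr0n ?muln_gt0 ?a0 ?expn_gt0 ?m0 //.
rewrite -[leLHS]ger0_norm // -sqrtr_sqr; apply: ler_wsqrtr.
by rewrite -natrX ler_nat leq_pmull.
Qed.

(** The lower bound for the part of the block in the square class of [n] turns f(n) / n into a
    multiple of V(n) / sqrt n. After exchanging sums, each [k] of the block carries the sum of 1 /
    sqrt n over its own class, at most a harmonic sum. *)
Lemma log_sum_le_dyadic f (y : nat) : (0 < y)%N ->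
  (forall k, (0 < k)%N -> 0 <= f k) ->
  (forall k j, (0 < k)%N -> (0 < j)%N -> f k <= f (k * j ^ 2)%N) ->
  \sum_(1 <= n < (4 * y).+1) f n / n%:R <=
  2 / Num.sqrt y%:R * (\sum_(y.+1 <= k < (4 * y).+1) f k) *
  \sum_(1 <= m < (4 * y).+1) m%:R^-1.
Proof.
move=> y0 f0 fM; have sy0 : 0 < Num.sqrt (y%:R : R) by rewrite sqrtr_gt0 ltr0n.
pose V n := \sum_(y.+1 <= k < (4 * y).+1 | sqfree_part k == sqfree_part n) f k.
apply: (@le_trans _ _ (2 / Num.sqrt y%:R *
    \sum_(1 <= n < (4 * y).+1) V n * (Num.sqrt n%:R)^-1)).
  rewrite mulr_sumr big_nat_cond [leRHS]big_nat_cond.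
  apply: ler_sum => n /andP[/andP[n0 n4] _].
  have n0' : 0 < (n%:R : R) by rewrite ltr0n.
  have sn0 : 0 < Num.sqrt (n%:R : R) by rewrite sqrtr_gt0.
  have := dyadic_class_ge n0 n4 f0 fM; rewrite -/(V n) => hV.
  rewrite [X in f n / X](_ : _ = Num.sqrt n%:R * Num.sqrt n%:R); last first.
    by rewrite -expr2 sqr_sqrtr // ltW.
  rewrite invfM mulrA mulrA ler_pM2r ?invr_gt0 //.
  apply: le_trans (_ : 2 / Num.sqrt y%:R * (f n * (Num.sqrt y%:R / (2 * Num.sqrt
    n%:R))) <= _).
    rewrite le_eqVlt; apply/orP; left; apply/eqP; field.
    by rewrite !gt_eqF.
  by rewrite ler_wpM2l // divr_ge0 // ltW.
rewrite -[leRHS]mulrA ler_wpM2l ?divr_ge0 ?sqrtr_ge0 //.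
rewrite /V; under eq_bigr do rewrite mulr_suml big_mkcond /=.
rewrite exchange_big_nat /= mulr_suml big_nat_cond [leRHS]big_nat_cond.
apply: ler_sum => k /andP[/andP[k0 _] _].
have {}k0 : (0 < k)%N by lia.
rewrite (eq_bigr (fun n => if sqfree_part n == sqfree_part k then
    f k * (Num.sqrt n%:R)^-1 else 0)); last by move=> n _; rewrite eq_sym.
rewrite -big_mkcond -mulr_sumr ler_wpM2l ?f0 //.
exact/square_class_sum_le/sqfree_part_gt0.
Qed.

End SquareClassSum.

(** * Fourier analysis modulo q *)

Local Open Scope classical_set_scope.
Local Open Scope ring_scope.

Section Trigonometry.
Variable R : realType.
Implicit Types x y : R.

(** The mean value theorem gives sin x = x cos z with 0 < z < x, and cos decreases on [0, pi]. *)
Lemma ge_sin_mul_cos x : 0 <= x <= pi -> x * cos x <= sin x.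
Proof.
move=> /andP[]; rewrite le_eqVlt => /orP[/eqP <- _|x0 xpi].
  by rewrite mul0r sin0.
have cs : {within `[0, x], continuous (@sin R)}.
  by apply: continuous_subspaceT => z; exact: continuous_sin.
have [z /andP[]] := MVT x0 (fun z _ => is_derive_sin z) cs.
rewrite !bnd_simp => z0 zx; rewrite sin0 !subr0 mulrC => ->.
rewrite ler_pM2l // ltW // ltr_cos // in_itv /=; apply/andP; split; lra.
Qed.

(** sin x = 2 sin(x/2) cos(x/2) >= x cos^2(x/2), and cos^2(x/2) >= 1/2 because cos x >= 0. *)
Lemma ge_sin_half x : 0 <= x <= pi / 2 -> x / 2 <= sin x.
Proof.
move=> /andP[x0 xpi]; have pi0 := @pi_gt0 R.
have h : x / 2 * cos (x / 2) <= sin (x / 2).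
  by apply: ge_sin_mul_cos; apply/andP; split; lra.
have c0 : 0 <= cos x by apply: cos_ge0_pihalf; apply/andP; split; lra.
have cx0 : 0 <= cos (x / 2) by apply: cos_ge0_pihalf; apply/andP; split; lra.
have x2 : x = (x / 2) *+ 2 by rewrite -mulr_natr divfK.
rewrite [X in _ <= sin X]x2 sin_mulr2n; rewrite [X in cos X]x2 cos_mulr2n in c0.
apply: le_trans (_ : cos (x / 2) * (x / 2 * cos (x / 2)) *+ 2 <= _); last first.
  by rewrite lerMn2r /= ler_wpM2l.
rewrite expr2 in c0; nra.
Qed.

End Trigonometry.

Lemma sum_coprime_reindex (R : nmodType) (q : nat) (G : nat -> R) b :
  (0 < q)%N -> coprime b q ->
  \sum_(0 <= m < q) G ((b * m) %% q)%N = \sum_(0 <= m < q) G m.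
Proof.
move=> q0 bq; rewrite !big_mkord.
pose h (i : 'I_q) : 'I_q := Ordinal (ltn_pmod (b * i) q0).
have hI : injective h.
  move=> i j /(congr1 val) /= /eqP E; apply/val_inj/eqP => /=.
  wlog ij : i j E / (i <= j)%N.
    by case: (leqP i j) => ij H; [apply: H | rewrite eq_sym; apply: H;
      rewrite 1?eq_sym // ltnW].
  move: E; rewrite eq_sym eqn_mod_dvd ?leq_mul // -mulnBr Gauss_dvdr 1?coprime_sym //.
  have [ji0|ji0] := posnP (j - i); first by rewrite eqn_leq ij /= -subn_eq0 ji0.
  move/(dvdn_leq ji0); have := ltn_ord j; lia.
by rewrite [RHS](reindex_inj hI).
Qed.

(** * Gauss sums of a real character *)

Section Fourier.
Variables (R : realType) (q : nat) (c : nat -> R).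

(** The real-valued form, on natural numbers, of a non-principal real character: non-principality
    enters as the vanishing of the sum over a period. *)
Definition quadratic_character :=
  [/\ forall n, c (n + q)%N = c n,
      forall m n, c (m * n)%N = c m * c n,
      forall n, [\/ c n = 0, c n = 1 | c n = -1],
      forall n, c n != 0 -> coprime n q &
      [/\ (0 < q)%N, c 1%N = 1 & \sum_(0 <= n < q) c n = 0]].

Hypothesis hc : quadratic_character.

Let cD n : c (n + q)%N = c n. Proof. by case: hc. Qed.
Let cM m n : c (m * n)%N = c m * c n. Proof. by case: hc. Qed.
Let c01 n : [\/ c n = 0, c n = 1 | c n = -1]. Proof. by case: hc. Qed.
Let c_coprime n : c n != 0 -> coprime n q. Proof. by case: hc => _ _ _ + _; apply. Qed.
Let q0 : (0 < q)%N. Proof. by case: hc => _ _ _ _ []. Qed.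
Let c1 : c 1%N = 1. Proof. by case: hc => _ _ _ _ []. Qed.
Let c_sum : \sum_(0 <= n < q) c n = 0. Proof. by case: hc => _ _ _ _ []. Qed.
Let qR : 0 < (q%:R : R). Proof. by rewrite ltr0n. Qed.

Lemma char_modn n : c (n %% q)%N = c n.
Proof.
rewrite [in RHS](divn_eq n q) addnC; elim: (n %/ q)%N => [|k IH].
  by rewrite mul0n addn0.
by rewrite mulSn addnCA addnC cD.
Qed.

Definition angle (k : nat) : R := k%:R * (pi *+ 2 / q%:R).
Definition cosq k := cos (angle k).
Definition sinq k := sin (angle k).

Lemma angleDq k : angle (k + q) = angle k + pi *+ 2.
Proof. by rewrite /angle natrD mulrDl; congr (_ + _); field; rewrite gt_eqF. Qed.

Lemma cosq_modn n : cosq (n %% q) = cosq n.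
Proof.
rewrite [in RHS](divn_eq n q) addnC; elim: (n %/ q)%N => [|k IH].
  by rewrite mul0n addn0.
by rewrite mulSn addnCA addnC /cosq angleDq cosD2pi.
Qed.

Lemma sinq_modn n : sinq (n %% q) = sinq n.
Proof.
rewrite [in RHS](divn_eq n q) addnC; elim: (n %/ q)%N => [|k IH].
  by rewrite mul0n addn0.
by rewrite mulSn addnCA addnC /sinq angleDq sinD2pi.
Qed.

(** Cosine and sine parts of the Gauss sum of c(m) e(a m / q); [fourier_power] is its squared
    modulus. *)
Definition fourier_cos a := \sum_(0 <= m < q) c m * cosq (a * m).
Definition fourier_sin a := \sum_(0 <= m < q) c m * sinq (a * m).
Definition fourier_power a := fourier_cos a ^+ 2 + fourier_sin a ^+ 2.

(** Substitute m -> b m, a permutation of the residues modulo [q]. *)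
Lemma fourier_cos_twist a b : coprime b q -> c b * fourier_cos (a * b) = fourier_cos a.
Proof.
move=> bq; rewrite /fourier_cos.
rewrite -(sum_coprime_reindex (fun m => c m * cosq (a * m)) q0 bq) mulr_sumr.
apply: eq_bigr => m _.
by rewrite char_modn cM -(cosq_modn (a * _)) modnMmr cosq_modn mulnA mulrA.
Qed.

Lemma fourier_sin_twist a b : coprime b q -> c b * fourier_sin (a * b) = fourier_sin a.
Proof.
move=> bq; rewrite /fourier_sin.
rewrite -(sum_coprime_reindex (fun m => c m * sinq (a * m)) q0 bq) mulr_sumr.
apply: eq_bigr => m _.
by rewrite char_modn cM -(sinq_modn (a * _)) modnMmr sinq_modn mulnA mulrA.
Qed.

Lemma fourier_power_twist a b : coprime b q -> c b ^+ 2 * fourier_power (a * b) =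
  fourier_power a.
Proof. by move=> bq; rewrite /fourier_power mulrDr -!exprMn fourier_cos_twist //
  fourier_sin_twist. Qed.

Lemma fourier_power_ge0 a : 0 <= fourier_power a.
Proof. by rewrite addr_ge0 ?sqr_ge0. Qed.

(** The Dirichlet kernel: 2 sin(t/2) cos(a t) = sin((a + 1/2) t) - sin((a - 1/2) t) telescopes. *)
Lemma sum_cos_telescope N (t : R) :
  2 * sin (t / 2) * (\sum_(0 <= a < N) cos (a%:R * t)) =
  sin (N%:R * t - t / 2) + sin (t / 2).
Proof.
elim: N => [|N IH]; first by rewrite big_geq // mulr0 mul0r sub0r sinN addNr.
rewrite big_nat_recr //= mulrDr IH.
rewrite (_ : N.+1%:R * t - t / 2 = N%:R * t + t / 2); last by rewrite -natr1; field.
rewrite sinB sinD; ring.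
Qed.

Lemma orthogonality m n : (m < q)%N -> (n < q)%N ->
  \sum_(0 <= a < q) (cosq (a * m) * cosq (a * n) + sinq (a * m) * sinq (a * n))
  = if m == n then q%:R else 0.
Proof.
wlog nm : m n / (n <= m)%N.
  move=> H mq nq; case: (leqP n m) => [/H|/ltnW mn]; first exact.
  rewrite eq_sym -(H _ _ mn) //; apply: eq_bigr => a _.
  by rewrite [in RHS]mulrC; congr (_ + _); rewrite mulrC.
move=> mq nq; case: eqVneq => [<-|mn].
  under eq_bigr do rewrite -!expr2 cos2Dsin2.
  by rewrite sumr_const_nat subn0.
have {nm}nm : (n < m)%N by rewrite ltn_neqAle eq_sym mn.
(* The summand is cos(a t). Since q t is a multiple of 2 pi, the boundary sines of the telescoped
   sum cancel; t/2 lies strictly between 0 and pi, so its sine can be divided out. *)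
set t : R := (m - n)%N%:R * (pi *+ 2 / q%:R).
have t2 : t / 2 = (m - n)%N%:R * pi / q%:R.
  by rewrite /t -mulr_natr; field; rewrite gt_eqF.
have st : 0 < sin (t / 2).
  apply: sin_gt0_pi; rewrite t2 divr_gt0 ?mulr_gt0 ?pi_gt0 ?ltr0n ?subn_gt0 //=.
  by rewrite ltr_pdivrMr // mulrC ltr_pM2l ?pi_gt0 // ltr_nat; lia.
rewrite (eq_bigr (fun a : nat => cos (a%:R * t))); last first.
  move=> a _; rewrite -cosB /angle !natrM; congr cos.
  by rewrite /t natrB 1?ltnW //; ring.
apply/eqP; move: (sum_cos_telescope q t).
rewrite (_ : q%:R * t - t / 2 = - (t / 2) + pi *+ 2 *+ (m - n)); last first.
  by rewrite addrC; congr (_ + _); rewrite /t -[RHS]mulr_natl; field; rewrite gt_eqF.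
rewrite (periodicn (@sinD2pi R)) sinN addNr => /eqP.
by rewrite mulf_eq0 mulf_eq0 pnatr_eq0 /= (gt_eqF st).
Qed.

Lemma fourier_inversion n :
  \sum_(0 <= a < q) (fourier_cos a * cosq (a * n) + fourier_sin a * sinq (a * n)) =
    q%:R * c n.
Proof.
rewrite -char_modn.
transitivity (\sum_(0 <= a < q) (fourier_cos a * cosq (a * (n %% q)) + fourier_sin a
  * sinq (a * (n %% q)))).
  apply: eq_bigr => a _; rewrite -(cosq_modn (a * n)) -(sinq_modn (a * n)).
  by rewrite -modnMmr cosq_modn sinq_modn.
have := ltn_pmod n q0; move: (n %% q)%N => {}n nq.
transitivity (\sum_(0 <= a < q) \sum_(0 <= m < q)
   c m * (cosq (a * m) * cosq (a * n) + sinq (a * m) * sinq (a * n))).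
  apply: eq_bigr => a _; rewrite /fourier_cos /fourier_sin !mulr_suml -big_split /=.
  by apply: eq_bigr => m _; ring.
rewrite exchange_big_nat /=.
rewrite (eq_big_nat _ _ (F2 := fun m => if m == n then q%:R * c n else 0)).
  rewrite -big_mkcond big_mkord (big_pred1 (Ordinal nq)) //.
move=> m /andP[_ mq]; rewrite -mulr_sumr orthogonality //.
by case: eqVneq => [->|]; rewrite ?mulr0 // mulrC.
Qed.

(** Expand one factor of each square, exchange sums and apply Fourier inversion. *)
Lemma parseval : \sum_(0 <= a < q) fourier_power a = q%:R * \sum_(0 <= m < q) c m ^+ 2.
Proof.
transitivity (\sum_(0 <= a < q) \sum_(0 <= m < q)
   c m * (fourier_cos a * cosq (a * m) + fourier_sin a * sinq (a * m))).
  apply: eq_bigr => a _; rewrite /fourier_power !expr2 {1}/fourier_cos [X in _ + X *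
    _]/fourier_sin.
  rewrite !mulr_suml -big_split /=; apply: eq_bigr => m _; ring.
rewrite exchange_big_nat /= mulr_sumr; apply: eq_bigr => m _.
by rewrite -mulr_sumr fourier_inversion expr2 mulrCA.
Qed.

Lemma fourier_power_modn a : fourier_power (a %% q) = fourier_power a.
Proof.
rewrite /fourier_power /fourier_cos /fourier_sin; congr (_ ^+ 2 + _ ^+ 2);
  apply: eq_bigr => m _.
  by rewrite -(cosq_modn (_ * m)) modnMml cosq_modn.
by rewrite -(sinq_modn (_ * m)) modnMml sinq_modn.
Qed.

Lemma sum_fourier_power_periods a :
  \sum_(0 <= j < a * q) fourier_power j = a%:R * \sum_(0 <= j < q) fourier_power j.
Proof.
elim: a => [|a IH]; first by rewrite mul0n big_geq // mul0r.
rewrite mulSn addnC (@big_cat_nat _ _ _ (a * q)) ?leq_addr //= IH.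
rewrite -natr1 mulrDl mul1r; congr (_ + _).
rewrite -{1}[(a * q)%N]add0n big_addn addKn; apply: eq_bigr => i _.
by rewrite -fourier_power_modn addnC modnMDl fourier_power_modn.
Qed.

(* Averaging [fourier_power (a b)] over the units [b], where each residue class
   is hit at most [a] times, replaces the evaluation of Gauss sums and does not need
   the character to be primitive. *)
Lemma fourier_power_le a : (0 < a)%N -> fourier_power a <= q%:R * a%:R.
Proof.
move=> a0; set N := \sum_(0 <= m < q) c m ^+ 2.
(* q = 1 is impossible: the sum over a period would be c(0) = c(1) = 1. So the term m = 1 occurs and
   contributes 1. *)
have N0 : 0 < N.
  have q1 : (1 < q)%N.
    rewrite ltn_neqAle q0 andbT; apply/eqP => q1.
    move: c_sum; rewrite -q1 big_nat1 => c00.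
    by have := cD 0; rewrite c00 add0n -q1 c1 => /eqP; rewrite oner_eq0.
  rewrite /N (@big_cat_nat _ _ _ 1) //= big_nat1 (@big_cat_nat _ _ _ 2) //= big_nat1 c1.
  rewrite ltr_wpDl ?sqr_ge0 // expr1n ltr_pwDl // sumr_ge0 // => *; exact: sqr_ge0.
rewrite -(ler_pM2r N0).
apply: (@le_trans _ _ (\sum_(0 <= b < q) fourier_power (a * b))).
  rewrite /N mulr_sumr; apply: ler_sum => b _.
  have [->|cb] := eqVneq (c b) 0; first by rewrite expr0n mulr0 fourier_power_ge0.
  rewrite mulrC.
  have b2 : c b ^+ 2 = 1.
    by case: (c01 b) cb => ->; rewrite ?eqxx // ?expr1n // sqrrN expr1n.
  by rewrite -(fourier_power_twist a (c_coprime cb)) b2 !mul1r.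
(* The points a b with b < q are distinct and lie within [a] periods, each of which Parseval
   evaluates. *)
apply: (@le_trans _ _ (\sum_(0 <= j < a * q) fourier_power j)); last first.
  by rewrite sum_fourier_power_periods parseval -/N mulrCA mulrA.
rewrite -(big_map (muln a) xpredT fourier_power); apply: ler_sum_subset.
- by rewrite map_inj_uniq ?iota_uniq // => i j /eqP; rewrite eqn_pmul2l // => /eqP.
- exact: iota_uniq.
- move=> k /mapP[b]; rewrite !mem_index_iota => /andP[_ bq] ->.
  by rewrite ltn_pmul2l.
- by move=> k _; exact: fourier_power_ge0.
Qed.

(** Replacing a by -a conjugates the Gauss sum: the cosine part stays and the sine part changes
    sign. *)
Lemma fourier_power_subn a : (a <= q)%N -> fourier_power (q - a) = fourier_power a.
Proof.
move=> aq; rewrite /fourier_power.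
have ang m : angle ((q - a) * m) = - angle (a * m) + pi *+ 2 *+ m.
  rewrite /angle -[_ *+ m]mulr_natl !natrM natrB //; field; by rewrite gt_eqF.
congr (_ + _).
  congr (_ ^+ 2); apply: eq_bigr => m _.
  by rewrite /cosq ang (periodicn (@cosD2pi R)) cosN.
rewrite -[RHS]sqrrN; congr (_ ^+ 2); rewrite -sumrN; apply: eq_bigr => m _.
by rewrite /sinq ang (periodicn (@sinD2pi R)) sinN mulrN.
Qed.

End Fourier.

(** * A bounded second antidifference of the character *)

Section SecondPrimitive.
Variables (R : realType) (q : nat) (c : nat -> R).
Hypothesis hc : quadratic_character q c.

Let q0 : (0 < q)%N. Proof. by case: hc => _ _ _ _ []. Qed.
Let c_sum : \sum_(0 <= n < q) c n = 0. Proof. by case: hc => _ _ _ _ []. Qed.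
Let qR : 0 < (q%:R : R). Proof. by rewrite ltr0n. Qed.

(** Comparison of a^(-3/2) with its integral: with t^2 = s^2 + 1, the term t^(-3) is at most 2/s -
    2/t, which telescopes. *)
Lemma sum_inv_mul_sqrt_le N :
  \sum_(1 <= a < N.+2) (a%:R * Num.sqrt (a%:R : R))^-1 <=
  3 - 2 / Num.sqrt (N.+1%:R : R).
Proof.
elim: N => [|N IH].
  by rewrite big_nat1 sqrtr1 mulr1 invr1; lra.
rewrite big_nat_recr //=; move: IH.
set S := \sum_(_ <= _ < _) _.
set s := Num.sqrt (N.+1%:R : R); set t := Num.sqrt (N.+2%:R : R).
have s0 : 0 < s by rewrite sqrtr_gt0.
have t0 : 0 < t by rewrite sqrtr_gt0.
have s2 : s ^+ 2 = N.+1%:R by rewrite sqr_sqrtr.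
have t2 : t ^+ 2 = N.+2%:R by rewrite sqr_sqrtr.
have ts : t ^+ 2 = s ^+ 2 + 1 by rewrite t2 s2 natr1.
rewrite -t2 => IH.
suff : (t ^+ 2 * t)^-1 <= 2 / s - 2 / t by lra.
have st : s <= t by apply: ler_wsqrtr; rewrite ler_nat.
rewrite (_ : 2 / s - 2 / t = 2 * (t - s) * t ^+ 2 / s / (t ^+ 2 * t)); last first.
  by field; rewrite !gt_eqF.
rewrite -[leLHS]mul1r ler_pM2r; last by rewrite invr_gt0 mulr_gt0 // exprn_gt0.
rewrite ler_pdivlMr // mul1r.
have : (t - s) * (t + s) = 1 by rewrite -subr_sqr ts; ring.
rewrite !expr2; nra.
Qed.

(** A second antidifference of [c]: the Fourier coefficient at [a] is divided by -4 sin^2(pi a / q),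
    the eigenvalue of the centred second difference on e(a n / q). The frequency a = 0 is absent
    since [c] has mean zero. *)
Definition second_primitive n : R :=
  - (q%:R^-1 * \sum_(1 <= a < q)
      (fourier_cos q c a * cosq R q (a * n) + fourier_sin q c a * sinq R q (a * n)) /
      (4 * sin (pi * a%:R / q%:R) ^+ 2)).

Lemma sin_pi_gt0 a : (0 < a < q)%N -> 0 < sin (pi * a%:R / q%:R : R).
Proof.
move=> /andP[a0 aq]; apply: sin_gt0_pi.
rewrite divr_gt0 ?mulr_gt0 ?pi_gt0 ?ltr0n //=.
by rewrite ltr_pdivrMr // ltr_pM2l ?pi_gt0 // ltr_nat.
Qed.

Lemma second_difference_primitive n :
  second_primitive n.+2 - 2 * second_primitive n.+1 + second_primitive n = c n.+1.
Proof.
rewrite /second_primitive.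
set S2 := \sum_(_ <= _ < _) _; set S1 := \sum_(_ <= _ < _) _.
set S0 := \sum_(_ <= _ < _) _.
suff key : S2 - 2 * S1 + S0 = - (q%:R * c n.+1).
  rewrite (_ : _ + _ = - (q%:R^-1 * (S2 - 2 * S1 + S0))); last by ring.
  by rewrite key mulrN opprK mulKf // gt_eqF.
rewrite /S2 /S1 /S0 mulr_sumr -sumrB -big_split /=.
rewrite -(fourier_inversion hc) [in RHS]big_ltn // mul0n.
have -> : fourier_cos q c 0 = 0.
  rewrite /fourier_cos; under eq_bigr do rewrite mul0n /cosq /angle mul0r cos0 mulr1.
  exact: c_sum.
have -> : sinq R q 0 = 0 by rewrite /sinq /angle mul0r sin0.
rewrite mul0r mulr0 !add0r -sumrN.
apply: eq_big_nat => a aq; have := sin_pi_gt0 aq.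
set t := pi * a%:R / q%:R => st.
have ang m : angle R q (a * m.+1) = angle R q (a * m) + t *+ 2.
  rewrite /angle /t mulnS natrD -[in RHS]mulr_natr -mulr_natr.
  by field; rewrite gt_eqF.
have angS : angle R q (a * n) = angle R q (a * n.+1) - t *+ 2 by rewrite ang addrK.
rewrite /cosq /sinq !(ang n.+1) angS.
rewrite cosD cosB sinD sinB cos_mulr2n cos2sin2; field.
by rewrite gt_eqF.
Qed.

(** For a <= q/2, sin(pi a / q) >= (pi/2) (a/q) >= a/q; with the bound q a for the squared Gauss sum
    this gives sqrt(q a) q^2 / (4 a^2). *)
Lemma sqrt_fourier_power_div_le a : (0 < a)%N -> (2 * a <= q)%N ->
  Num.sqrt (fourier_power q c a) / (4 * sin (pi * a%:R / q%:R) ^+ 2) <=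
  q%:R ^+ 2 * Num.sqrt q%:R / 4 * (a%:R * Num.sqrt (a%:R : R))^-1.
Proof.
move=> a0 aq; have aR : 0 < (a%:R : R) by rewrite ltr0n.
have sa0 : 0 < Num.sqrt (a%:R : R) by rewrite sqrtr_gt0.
have sina : a%:R / q%:R <= sin (pi * a%:R / q%:R : R).
  apply: le_trans (ge_sin_half _); last first.
    rewrite divr_ge0 ?mulr_ge0 ?pi_ge0 //=.
    rewrite -mulrA ler_wpM2l ?pi_ge0 // ler_pdivrMr // mulrC ler_pdivlMr //.
    by rewrite mulrC -natrM ler_nat.
  rewrite (_ : _ / 2 = pi / 2 * (a%:R / q%:R)); last by field; rewrite gt_eqF.
  by rewrite ler_peMl ?divr_ge0 // pihalf_ge1.
have aq0 : 0 < a%:R / q%:R :> R by rewrite divr_gt0.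
have s0 := lt_le_trans aq0 sina.
apply: (@le_trans _ _ (Num.sqrt (q%:R * a%:R) / (4 * (a%:R / q%:R) ^+ 2))).
  apply: ler_pM; rewrite ?sqrtr_ge0 ?invr_ge0 ?mulr_ge0 ?sqr_ge0 ?(ltW s0) //.
    by apply: ler_wsqrtr; apply: fourier_power_le.
  rewrite lef_pV2 ?posrE ?mulr_gt0 ?exprn_gt0 ?invr_gt0 //.
  by rewrite ler_wpM2l // ler_sqr ?nnegrE ?(ltW aq0) ?(ltW s0).
rewrite sqrtrM ?ler0n // le_eqVlt; apply/orP; left; apply/eqP.
have aa : a%:R = Num.sqrt (a%:R : R) ^+ 2 by rewrite sqr_sqrtr.
move: (Num.sqrt a%:R) sa0 aa => s s0' ->; field.
by rewrite !gt_eqF.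
Qed.

(** The bounds at a and q - a agree, so the case a <= q/2 covers all frequencies, and the sum of
    a^(-3/2) is at most 3. The outcome is (3/2) q^(3/2), rounded up. *)
Lemma second_primitive_le n :
  `|second_primitive n| <= 2 * (q%:R * Num.sqrt q%:R).
Proof.
pose B a := q%:R ^+ 2 * Num.sqrt q%:R / 4 * (a%:R * Num.sqrt (a%:R : R))^-1.
have B0 a : 0 <= B a by rewrite /B !mulr_ge0 ?sqr_ge0 ?sqrtr_ge0 // invr_ge0 mulr_ge0
  ?sqrtr_ge0.
rewrite /second_primitive normrN normrM ger0_norm ?invr_ge0 ?ler0n //.
rewrite ler_pdivrMl //; apply: le_trans (ler_norm_sum _ _ _) _.
apply: (@le_trans _ _ (\sum_(1 <= a < q) (B a + B (q - a)%N))).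
  rewrite big_nat_cond [leRHS]big_nat_cond.
  apply: ler_sum => a /andP[a0q _]; have [a0 aq] := andP a0q.
  have s0 := ltW (sin_pi_gt0 a0q).
  rewrite normrM [X in _ * X]ger0_norm ?invr_ge0 ?mulr_ge0 ?sqr_ge0 ?s0 //.
  apply: (@le_trans _ _ (Num.sqrt (fourier_power q c a) / (4 * sin (pi * a%:R / q%:R)
    ^+ 2))).
    rewrite ler_wpM2r ?invr_ge0 ?mulr_ge0 ?sqr_ge0 ?s0 //.
    rewrite -sqrtr_sqr; apply: ler_wsqrtr; rewrite /fourier_power.
    have := cos2Dsin2 (angle R q (a * n)); rewrite -/(cosq _ _ _) -/(sinq _ _ _).
    set x := cosq _ _ _; set y := sinq _ _ _; set u := fourier_cos _ _ _;
      set v := fourier_sin _ _ _.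
    (* Cauchy-Schwarz: the difference of the two sides is the square in Lagrange's identity. *)
    move=> xy; rewrite -[leRHS]mulr1 -xy -subr_ge0.
    rewrite (_ : _ - _ = (u * y - v * x) ^+ 2) ?sqr_ge0 //; ring.
  have [aq2|aq2] := leqP (2 * a) q.
    by apply: le_trans (sqrt_fourier_power_div_le a0 aq2) _; rewrite lerDl.
  have -> : sin (pi * a%:R / q%:R) = sin (pi * (q - a)%N%:R / q%:R : R).
    rewrite natrB 1?ltnW //.
    rewrite (_ : pi * (q%:R - a%:R) / q%:R = - (pi * a%:R / q%:R) + pi); last first.
      by field; rewrite gt_eqF.
    by rewrite sinDpi sinN opprK.
  rewrite -fourier_power_subn 1?ltnW //.
  apply: le_trans (sqrt_fourier_power_div_le _ _) _; rewrite ?subn_gt0 //; first by lia.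
  by rewrite lerDr.
rewrite big_split /= [X in _ + X]big_nat_rev /=.
rewrite (eq_big_nat _ _ (F2 := B) (F1 := fun i => B (q - (1 + q - i.+1))%N));
  last first.
  by move=> i /andP[i0 iq]; congr B; lia.
rewrite -mulr_sumr.
have : \sum_(1 <= a < q) (a%:R * Num.sqrt (a%:R : R))^-1 <= 3.
  have [q2|] := leqP 2 q; last by move=> ?; rewrite big_geq //; lra.
  case: q q2 => [|[|N]] // _; apply: le_trans (sum_inv_mul_sqrt_le N) _.
  by rewrite lerBlDr lerDl divr_ge0 ?sqrtr_ge0.
set S := \sum_(_ <= _ < _) _ => S3.
have K0 : 0 <= q%:R ^+ 2 * Num.sqrt q%:R / 4 :> R.
  by rewrite !mulr_ge0 ?sqr_ge0 ?sqrtr_ge0.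
have := ler_wpM2l K0 S3.
rewrite (_ : q%:R * (2 * _) = q%:R ^+ 2 * Num.sqrt q%:R / 4 * 8); last by field.
by move=> h; lra.
Qed.

End SecondPrimitive.

(** * The convex kernel *)

Section Kernel.
Variable R : realType.
Implicit Types u h t : R.

(** Serves as a limit: errors of order 1/D disappear when the truncation point [D] is free. *)
Lemma le0_of_le_div (x K : R) (N : nat) :
  (forall D, (N <= D)%N -> x <= K / D.+1%:R) -> x <= 0.
Proof.
move=> H; rewrite leNgt; apply/negP => x0.
have := archi_boundP (ltW (divr_gt0 (ltr_pwDl x0 (normr_ge0 K)) x0)).
set B := Num.bound _ => hB.
have := H (N + B)%N (leq_addr _ _); rewrite ler_pdivlMr // leNgt => /negP; apply.
apply: (@lt_le_trans _ _ (x * B%:R)).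
  rewrite mulrC -ltr_pdivrMr //; apply: le_lt_trans hB.
  by rewrite ler_pM2r ?invr_gt0 // (le_trans (ler_norm K)) // lerDr ltW.
by rewrite ler_pM2l // ler_nat -addnS; lia.
Qed.

(** Iteration gives F(u, h) >= -M / 2^J. The induction keeps the weaker -M / (J+1), which is
    preserved because 2 (J+1) >= J+2. *)
Lemma halving_ge0 (F : R -> R -> R) (M : R) :
  (forall u h, 0 < u -> 0 <= h -> F (u / 2) (h / 2) / 2 <= F u h) ->
  (forall u h, 0 < u -> 0 <= h -> - M <= F u h) ->
  forall u h, 0 < u -> 0 <= h -> 0 <= F u h.
Proof.
move=> F2 FM.
have M0 : 0 <= M \/ M < 0 by case: (lerP 0 M); [left | right].
case: M0 => [M0|M0] u h u0 h0; last by apply: le_trans (FM u h u0 h0); lra.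
have key J : forall u h, 0 < u -> 0 <= h -> - (M / J.+1%:R) <= F u h.
  elim: J => [|J IH] {h0 u0}u {}h u0 h0; first by rewrite divr1 FM.
  apply: le_trans (F2 _ _ u0 h0).
  have := IH (u / 2) (h / 2) ltac:(lra) ltac:(lra).
  have : M / J.+1%:R / 2 <= M / J.+2%:R.
    rewrite -mulrA ler_wpM2l // -invfM lef_pV2 ?posrE ?mulr_gt0 ?ltr0n //.
    by rewrite -natrM ler_nat; lia.
  by move: (M / J.+1%:R) (M / J.+2%:R) (F _ _) => a b z; lra.
rewrite -oppr_le0; apply: (@le0_of_le_div _ M 0) => J _.
by rewrite lerNl key.
Qed.

Definition fermi t : R := (1 + expR t)^-1.

Let fermi_pos t : 0 < 1 + expR t.
Proof. by rewrite addr_gt0 ?expR_gt0. Qed.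

Lemma fermi_decr t h : 0 <= h -> 0 <= fermi t - fermi (t + h).
Proof.
move=> h0; rewrite subr_ge0 lef_pV2 ?posrE ?fermi_pos // lerD2l ler_expR; lra.
Qed.

(** Reduces to e^(t+h) - e^t <= h e^(t+h), that is, to 1 - h <= e^(-h). *)
Lemma fermi_lipschitz t h : 0 <= h -> fermi t - fermi (t + h) <= h.
Proof.
move=> h0.
have Et := expR_gt0 t; have Eth := expR_gt0 (t + h).
rewrite /fermi (_ : _ - _ = (expR (t + h) - expR t) / ((1 + expR t) * (1 + expR (t +
  h)))).
  rewrite ler_pdivrMr ?mulr_gt0 ?fermi_pos //.
  have : expR (t + h) - expR t <= h * expR (t + h).
    have := expR_ge1Dx (- h); rewrite expRN expRD => H.
    have Eh := expR_gt0 h.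
    have : (1 - h) * (expR t * expR h) <= expR t.
      apply: (@le_trans _ _ ((expR h)^-1 * (expR t * expR h))).
        by rewrite ler_wpM2r // mulr_ge0 // ltW.
      by rewrite mulrCA mulVf ?mulr1 // gt_eqF.
    lra.
  move=> H; apply: le_trans H _; rewrite ler_wpM2l //.
  by rewrite mulrDl mul1r mulrDr mulr1; have := mulr_gt0 Et Eth; lra.
by field; rewrite !gt_eqF ?fermi_pos.
Qed.

(** With E = e^t and F = e^h the numerator of the second difference is E (F - 1)^2 (E F - 1), and t,
    h >= 0 make the last factor nonnegative. *)
Lemma fermi_convex t h : 0 <= t -> 0 <= h ->
  0 <= fermi t - 2 * fermi (t + h) + fermi (t + 2 * h).
Proof.
move=> t0 h0; rewrite /fermi.
have -> : expR (t + 2 * h) = expR t * expR h ^+ 2.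
  by rewrite expRD mulr_natl mulr2n expRD expr2.
rewrite expRD; have := expR_ge1Dx t; have := expR_ge1Dx h.
have := expR_gt0 t; have := expR_gt0 h.
move: (expR t) (expR h) => E F F0 E0 hF hE.
have E1 : 1 <= E by lra.
have F1 : 1 <= F by lra.
rewrite [X in _ <= X](_ : _ = E * (F - 1) ^+ 2 * (E * F - 1) /
   ((1 + E) * (1 + E * F) * (1 + E * F ^+ 2))).
  have EF : 1 <= E * F by rewrite -[1]mulr1 ler_pM.
  have D1 : 0 < 1 + E by lra.
  have D2 : 0 < 1 + E * F by lra.
  have D3 : 0 < 1 + E * F ^+ 2 by rewrite addr_gt0 // mulr_gt0 // exprn_gt0.
  rewrite divr_ge0 //; last by rewrite !mulr_ge0 // ltW.
  by rewrite mulr_ge0 ?subr_ge0 // mulr_ge0 ?sqr_ge0 // ltW.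
field; rewrite !gt_eqF // ?addr_gt0 // ?mulr_gt0 // ?exprn_gt0 //.
Qed.

(** For u > 0, the amount by which the sum of e^(-m u) over m >= 1 falls short of the integral
    1/u. *)
Definition bose_defect u : R := u^-1 - (expR u - 1)^-1.

Let expB1_gt0 u : 0 < u -> 0 < expR u - 1.
Proof. by move=> u0; rewrite subr_gt0 expR_gt1. Qed.

(* Hence [bose_defect u] is the series of the [2^-j * fermi (u / 2^j)]: it
   inherits from [fermi] monotonicity, convexity and a Lipschitz bound. *)
Lemma bose_defect_half u : 0 < u ->
  bose_defect u = (bose_defect (u / 2) + fermi (u / 2)) / 2.
Proof.
move=> u0; have u20 : 0 < u / 2 by lra.
have := expB1_gt0 u20; have := fermi_pos (u / 2); rewrite /bose_defect /fermi.
have -> : expR u = expR (u / 2) ^+ 2 by rewrite expr2 -expRD; congr expR; field.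
move: (expR (u / 2)) => E E1 E2; field.
rewrite !gt_eqF // -[1](expr1n _ 2) subr_sqr; by rewrite ?mulr_gt0 // addrC.
Qed.

Lemma bose_defect_ge0 u : 0 < u -> 0 <= bose_defect u.
Proof.
move=> u0; rewrite subr_ge0 lef_pV2 ?posrE ?expB1_gt0 //.
by have := expR_ge1Dx u; lra.
Qed.

(** Equivalent to (1 - u) e^u <= 1, that is, to 1 - u <= e^(-u). *)
Lemma bose_defect_le1 u : 0 < u -> bose_defect u <= 1.
Proof.
move=> u0; have := expB1_gt0 u0; rewrite /bose_defect => E0.
have : u^-1 <= expR u / (expR u - 1).
  rewrite -lef_pV2 ?posrE ?invr_gt0 ?divr_gt0 ?expR_gt0 // invrK invf_div.
  rewrite ler_pdivrMr ?expR_gt0 //.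
  have := expR_ge1Dx (- u); rewrite expRN => H.
  have Eu := expR_gt0 u.
  have : (1 - u) * expR u <= 1.
    by rewrite -[leRHS](mulVf (lt0r_neq0 Eu)) ler_wpM2r // ltW.
  lra.
rewrite (_ : expR u / _ = 1 + (expR u - 1)^-1); first lra.
by field; rewrite gt_eqF.
Qed.

Lemma bose_defect_le_inv u : 0 < u -> bose_defect u <= u^-1.
Proof. by move=> u0; rewrite gerBl invr_ge0 ltW // expB1_gt0. Qed.

Lemma bose_defect_decr u h : 0 < u -> 0 <= h ->
  0 <= bose_defect u - bose_defect (u + h).
Proof.
apply: (halving_ge0 (F := fun u h => bose_defect u - bose_defect (u + h)) (M := 1)).
  move=> {}u {}h u0 h0; rewrite (bose_defect_half u0) (@bose_defect_half (u + h));
    last by lra.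
  have := @fermi_decr (u / 2) (h / 2) ltac:(lra); rewrite -mulrDl; lra.
move=> {}u {}h u0 h0; have := bose_defect_ge0 u0.
have := @bose_defect_le1 (u + h) ltac:(lra); lra.
Qed.

(** The constant 1/2 survives halving: in [bose_defect_half] the [fermi] part adds at most h/4, and
    half the bound at h/2 is h/8. *)
Lemma bose_defect_lipschitz u h : 0 < u -> 0 <= h ->
  bose_defect u - bose_defect (u + h) <= h / 2.
Proof.
move=> u0 h0; rewrite -subr_ge0; move: u h u0 h0.
apply: (halving_ge0 (F := fun u h => h / 2 - (bose_defect u - bose_defect (u + h)))
  (M := 1)).
  move=> u h u0 h0; rewrite (bose_defect_half u0) (@bose_defect_half (u + h));
    last by lra.
  have := @fermi_lipschitz (u / 2) (h / 2) ltac:(lra); rewrite -mulrDl; lra.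
move=> u h u0 h0; have := bose_defect_le1 u0.
have := @bose_defect_ge0 (u + h) ltac:(lra); lra.
Qed.

Lemma bose_defect_convex u h : 0 < u -> 0 <= h ->
  0 <= bose_defect u - 2 * bose_defect (u + h) + bose_defect (u + 2 * h).
Proof.
apply: (halving_ge0 (F := fun u h => bose_defect u - 2 * bose_defect (u + h) +
                       bose_defect (u + 2 * h)) (M := 2)).
  move=> {}u {}h u0 h0; rewrite (bose_defect_half u0) (@bose_defect_half (u + h));
    last by lra.
  rewrite (@bose_defect_half (u + 2 * h)); last by lra.
  have := @fermi_convex (u / 2) (h / 2) ltac:(lra) ltac:(lra).
  rewrite -!mulrDl mulrA -mulrDl; lra.
move=> {}u {}h u0 h0; have := bose_defect_ge0 u0.
have := @bose_defect_ge0 (u + 2 * h) ltac:(lra).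
have := @bose_defect_le1 (u + h) ltac:(lra); lra.
Qed.

End Kernel.

(** * Summation by parts *)

Section AbelSummation.
Variable R : realType.
Implicit Types c v B P : nat -> R.

Lemma telescope_decr v m n : (m <= n)%N ->
  \sum_(m <= d < n) (v d - v d.+1) = v m - v n.
Proof.
move=> mn; rewrite (@telescope_sumr_eq _ m n (fun d => - v d)) //.
  by rewrite opprK addrC.
by move=> k _; rewrite opprK addrC.
Qed.

(** Summation by parts against the partial sums from [m]; the nonnegative decrements of [v]
    telescope. *)
Lemma abel_bound c v K m n : (m <= n)%N ->
  (forall k, (m <= k)%N -> v k.+1 <= v k) -> (forall k, (m <= k)%N -> 0 <= v k) ->
  (forall k, (m <= k)%N -> `|\sum_(m <= d < k) c d| <= K) ->
  `|\sum_(m <= d < n) c d * v d| <= K * v m.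
Proof.
move=> mn vd v0 cK.
pose S k := \sum_(m <= d < k) c d.
have -> : \sum_(m <= d < n) c d * v d =
    S n * v n + \sum_(m <= d < n) S d.+1 * (v d - v d.+1).
  rewrite -(subnK mn); elim: (n - m)%N => [|k IH].
    by rewrite add0n /S !big_geq // mul0r addr0.
  rewrite addSn !big_nat_recr ?leq_addl //= IH /S big_nat_recr ?leq_addl //=; ring.
apply: le_trans (ler_normD _ _) _; rewrite normrM (ger0_norm (v0 n mn)).
apply: (@le_trans _ _ (K * v n + K * (v m - v n))); last by rewrite -mulrDr addrC subrK.
apply: lerD; first by rewrite ler_wpM2r ?v0 ?cK.
apply: le_trans (ler_norm_sum _ _ _) _.
rewrite -telescope_decr // mulr_sumr big_nat_cond [leRHS]big_nat_cond.
apply: ler_sum => d /andP[/andP[md dn] _].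
have vdd : 0 <= v d - v d.+1 by rewrite subr_ge0 vd.
by rewrite normrM (ger0_norm vdd) ler_wpM2r // cK // leqW.
Qed.

(** Summation by parts twice: the second differences of a convex weight are nonnegative and
    telescope. The boundary term at the origin can be as large as 2 M B(1), so it is kept apart, to
    be compared between two step sizes. *)
Lemma abel_convex_bound c B P M N :
  (forall n, P n.+2 - 2 * P n.+1 + P n = c n.+1) -> (forall n, `|P n| <= M) ->
  (forall k, 0 <= B k.+1) -> (forall k, B k.+2 <= B k.+1) ->
  (forall k, 0 <= B k.+1 - 2 * B k.+2 + B k.+3) ->
  `|\sum_(1 <= d < N.+1) c d * B d + (P 1%N - P 0%N) * B 1%N| <=
  2 * M * B N.+1 + 2 * M * (B 1%N - B 2%N).
Proof.
move=> Pc PM B0 Bd Bc.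
pose C k := B k - B k.+1.
have -> : \sum_(1 <= d < N.+1) c d * B d + (P 1%N - P 0%N) * B 1%N =
    (P N.+1 - P N) * B N.+1 + P N.+1 * C N.+1 - P 1%N * C 1%N +
    \sum_(1 <= d < N.+1) P d.+1 * (C d - C d.+1).
  elim: N => [|N IH]; first by rewrite !big_geq //; ring.
  rewrite [X in X + _ = _]big_nat_recr //= [X in _ = _ + X]big_nat_recr //= addrAC IH
    /C -Pc; ring.
have C0 k : 0 <= C k.+1 by rewrite subr_ge0.
have Cd k : 0 <= C k.+1 - C k.+2 by have := Bc k; rewrite /C; lra.
have b1 : `|(P N.+1 - P N) * B N.+1| <= 2 * M * B N.+1.
  rewrite normrM (ger0_norm (B0 N)) ler_wpM2r //.
  by apply: le_trans (ler_normB _ _) _; have := PM N.+1; have := PM N; lra.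
have b2 : `|P N.+1 * C N.+1| <= M * C N.+1 by rewrite normrM (ger0_norm (C0 N))
  ler_wpM2r.
have b3 : `|P 1%N * C 1%N| <= M * C 1%N by rewrite normrM (ger0_norm (C0 0%N))
  ler_wpM2r.
have b4 : `|\sum_(1 <= d < N.+1) P d.+1 * (C d - C d.+1)| <= M * (C 1%N - C N.+1).
  rewrite -telescope_decr //; apply: le_trans (ler_norm_sum _ _ _) _.
  rewrite mulr_sumr big_nat_cond [leRHS]big_nat_cond.
  apply: ler_sum => -[|d] /andP[/andP[md dn] _] //.
  by rewrite normrM (ger0_norm (Cd d)) ler_wpM2r.
apply: le_trans (ler_normD _ _) _.
apply: le_trans (lerD (ler_normB _ _) b4) _.
have := ler_normD ((P N.+1 - P N) * B N.+1) (P N.+1 * C N.+1).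
move: b1 b2 b3 => b1 b2 b3 b5; rewrite -/(C 1%N); lra.
Qed.

End AbelSummation.

(** * Exponentially smoothed divisor sums *)

Section SmoothedSum.
Variables (R : realType) (q : nat) (c : nat -> R).
Hypothesis hc : quadratic_character q c.

Let c01 n : [\/ c n = 0, c n = 1 | c n = -1]. Proof. by case: hc. Qed.

Lemma char_norm_le1 n : `|c n| <= 1.
Proof. by case: (c01 n) => ->; rewrite ?normr0 ?normrN ?normr1. Qed.

Lemma sum_divsum_weight (w : nat -> R) D :
  \sum_(1 <= n < D.+1) divsum c n * w n =
  \sum_(1 <= d < D.+1) c d * \sum_(1 <= m < (D %/ d).+1) w (d * m)%N.
Proof.
transitivity (\sum_(1 <= n < D.+1) \sum_(1 <= d < D.+1) if (d %| n)%N then c d * w n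
  else 0).
  apply: eq_big_nat => n /andP[n0 nD]; rewrite /divsum mulr_suml -big_mkcond /=.
  rewrite -[RHS]big_filter; apply: perm_big; apply: uniq_perm.
  - exact: divisors_uniq.
  - by rewrite filter_uniq // iota_uniq.
  - move=> d; rewrite mem_filter -dvdn_divisors // mem_index_iota.
    case: (boolP (d %| n)%N) => //= dn; have := dvdn_leq n0 dn.
    by have := dvdn_gt0 n0 dn; lia.
rewrite exchange_big_nat /=; apply: eq_big_nat => d /andP[d0 _].
by rewrite -big_mkcond /= -mulr_sumr sum_multiples.
Qed.

(** Taking the difference of two scales lets the boundary terms of the double summation by parts
    cancel up to O(h). *)
Definition smooth_weight (h : R) (n : nat) : R :=
  expR (- (n%:R * h)) - expR (- (n%:R * (2 * h))).

Lemma geometric_expR (u : R) N : 0 < u ->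
  \sum_(1 <= m < N.+1) expR (- (m%:R * u)) =
  (1 - expR (- (N%:R * u))) / (expR u - 1).
Proof.
move=> u0; have E0 : 0 < expR u - 1 by rewrite subr_gt0 expR_gt1.
elim: N => [|N IH]; first by rewrite big_geq // mul0r oppr0 expR0 subrr mul0r.
rewrite big_nat_recr //= IH.
have -> : - (N.+1%N%:R * u) = - (N%:R * u) - u by rewrite -natr1; ring.
rewrite expRD !expRN; field.
by rewrite !gt_eqF // expR_gt0.
Qed.

(** Both sums are geometric, and 1/(e^u - 1) is 1/u minus [bose_defect u]; the main parts leave 1/u
    - 1/(2u) = 1/(2u). *)
Lemma smooth_weight_multiples (h : R) d N : 0 < h -> (0 < d)%N ->
  exists2 e, \sum_(1 <= m < N.+1) smooth_weight h (d * m) =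
     (2 * (d%:R * h))^-1 -
     (bose_defect (d%:R * h) - bose_defect (d%:R * (2 * h))) - e &
  0 <= e <= expR (- ((d * N)%N%:R * h)) / h.
Proof.
move=> h0 d0; have d1 : 1 <= d%:R :> R by rewrite ler1n.
set u := d%:R * h; have u0 : 0 < u by rewrite mulr_gt0 // ltr0n.
have u2 : d%:R * (2 * h) = 2 * u by rewrite mulrCA.
have v0 : 0 < 2 * u by lra.
have E0 : 0 < expR u - 1 by rewrite subr_gt0 expR_gt1.
have F0 : 0 < expR (2 * u) - 1 by rewrite subr_gt0 expR_gt1.
pose w := expR (- (N%:R * u)).
have w0 : 0 < w by apply: expR_gt0.
have w1 : w <= 1 by rewrite expR_le1 oppr_le0 mulr_ge0 // ltW.
(* The contribution of the tails beyond [N] of the two geometric series, with w = e^(-N u). *)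
exists (w / (expR u - 1) - w ^+ 2 / (expR (2 * u) - 1)).
  transitivity (\sum_(1 <= m < N.+1) (expR (- (m%:R * u)) - expR (- (m%:R * (2 * u))))).
    apply: eq_bigr => m _; rewrite /smooth_weight natrM.
    by congr (expR (- _) - expR (- _)); rewrite /u; ring.
  rewrite sumrB !geometric_expR // u2 /bose_defect.
  have -> : expR (- (N%:R * (2 * u))) = w ^+ 2.
    by rewrite expr2 -expRD; congr expR; ring.
  rewrite -/w; field; rewrite !gt_eqF //.
have -> : expR (- ((d * N)%N%:R * h)) = w.
  by rewrite /w natrM; congr expR; rewrite /u; ring.
have EF : (expR (2 * u) - 1)^-1 <= (expR u - 1)^-1.
  by rewrite lef_pV2 ?posrE // lerB // ler_expR; lra.
have ww : w ^+ 2 <= w by rewrite expr2 -[leRHS]mulr1 ler_wpM2l // ltW.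
have Eh : (expR u - 1)^-1 <= h^-1.
  rewrite lef_pV2 ?posrE //; have := expR_ge1Dx u.
  have : h <= u by rewrite /u -[leLHS]mul1r ler_wpM2r // ltW.
  lra.
have Fi0 : 0 <= (expR (2 * u) - 1)^-1 by rewrite invr_ge0 ltW.
have := ler_pM (sqr_ge0 w) Fi0 ww EF.
have F1 : 0 <= w ^+ 2 / (expR (2 * u) - 1) by rewrite divr_ge0 ?sqr_ge0 // ltW.
have := ler_wpM2l (ltW w0) Eh.
move=> p1 p2; apply/andP; split; lra.
Qed.

(** The convex bound is used at steps h and 2h. With M = 2 q^(3/2), the Lipschitz terms give M h + 2
    M h, the boundary terms combine to at most 2M times h/2, and the terms at D+1 give 3 M / h /
    (D+1). *)
Lemma sum_char_bose_le h D : 0 < h ->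
  `|\sum_(1 <= d < D.+1) c d *
     (bose_defect (d%:R * h) - bose_defect (d%:R * (2 * h)))| <=
  8 * (q%:R * Num.sqrt q%:R) * h + 6 * (q%:R * Num.sqrt q%:R) / h / D.+1%:R.
Proof.
move=> h0; set P := second_primitive q c.
pose M : R := 2 * (q%:R * Num.sqrt q%:R).
have PM n : `|P n| <= M by apply: second_primitive_le.
have M0 : 0 <= M := le_trans (normr_ge0 _) (PM 0).
have bnd k : 0 < k ->
  `|\sum_(1 <= d < D.+1) c d * bose_defect (d%:R * k) + (P 1%N - P 0%N) * bose_defect
    (1%N%:R * k)|
    <= M * k + 2 * M / k / D.+1%:R.
  move=> k0; have kn n : 0 < n.+1%N%:R * k :> R by rewrite mulr_gt0 // ltr0n.
  have := @abel_convex_bound R c (fun d => bose_defect (d%:R * k)) P M D.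
  move=> /(_ _ PM) H; apply: le_trans (H _ _ _ _) _ => {H}.
  - by move=> n; apply: second_difference_primitive.
  - by move=> n; apply: bose_defect_ge0.
  - move=> n; rewrite -subr_ge0 -[n.+2%:R]natr1 mulrDl mul1r.
    by apply: bose_defect_decr => //; apply: ltW.
  - move=> n.
    have -> : n.+2%N%:R * k = n.+1%N%:R * k + k by rewrite -[n.+2%:R]natr1 mulrDl mul1r.
    have -> : n.+3%:R * k = n.+1%N%:R * k + 2 * k.
      by rewrite -[n.+3%:R]natr1 -[n.+2%:R]natr1; ring.
    by apply: bose_defect_convex => //; apply: ltW.
  have e1 := bose_defect_le_inv (kn D).
  have e2 : bose_defect (1%N%:R * k) - bose_defect (2%N%:R * k) <= k / 2.
    have -> : 2%N%:R * k = 1%N%:R * k + k by ring.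
    by apply: bose_defect_lipschitz; rewrite ?mul1r // ltW.
  have M2 : 0 <= 2 * M by lra.
  have := ler_wpM2l M2 e1; have := ler_wpM2l M2 e2.
  rewrite -[2 * M / k / _]mulrA -invfM (mulrC k D.+1%:R).
  move: (bose_defect _) (bose_defect _) (bose_defect _) (D.+1%:R * k)^-1 => b1 b2 b3
    e; lra.
have k2 : 0 < 2 * h by lra.
have := bnd _ h0; have := bnd _ k2.
set S1 := \sum_(_ <= _ < _) _; set S2 := \sum_(_ <= _ < _) _.
move=> b1 b2.
rewrite (_ : \sum_(_ <= _ < _) _ = S2 - S1); last first.
  by rewrite /S1 /S2 -sumrB; apply: eq_bigr => d _; rewrite mulrBr.
have e3 : `|(P 1%N - P 0%N) * (bose_defect (1%N%:R * h) - bose_defect (1%N%:R * (2 *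
  h)))| <= M * h.
  rewrite !mul1r normrM.
  have p1 : `|P 1%N - P 0%N| <= 2 * M.
    by apply: le_trans (ler_normB _ _) _; have := PM 1; have := PM 0; lra.
  have e : `|bose_defect h - bose_defect (2 * h)| <= h / 2.
    have -> : 2 * h = h + h by ring.
    rewrite ger0_norm; last by apply: bose_defect_decr => //; apply: ltW.
    by apply: bose_defect_lipschitz => //; apply: ltW.
  by have := ler_pM (normr_ge0 _) (normr_ge0 _) p1 e; lra.
have -> : S2 - S1 = (S2 + (P 1%N - P 0%N) * bose_defect (1%N%:R * h)) -
   (S1 + (P 1%N - P 0%N) * bose_defect (1%N%:R * (2 * h))) -
   (P 1%N - P 0%N) * (bose_defect (1%N%:R * h) - bose_defect (1%N%:R * (2 * h))) by
     ring.
apply: le_trans (ler_normB _ _) _.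
apply: le_trans (lerD (ler_normB _ _) e3) _.
apply: le_trans (lerD (lerD b2 b1) (lexx _)) _.
rewrite -/(M) /M le_eqVlt; apply/orP; left; apply/eqP; field.
by rewrite !gt_eqF // ltr0n.
Qed.

End SmoothedSum.

(** * Dyadic blocks *)

Section Dyadic.
Variables (R : realType) (q : nat) (c : nat -> R) (L1 : R).
Hypothesis hc : quadratic_character q c.
(** This pins [L1] down as L(1), with a rate of convergence for the truncated sums. *)
Hypothesis hL1 : forall D,
  `|\sum_(1 <= d < D.+1) c d / d%:R - L1| <= 2 * q%:R / D.+1%:R.

Let q0 : (0 < q)%N. Proof. by case: hc => _ _ _ _ []. Qed.
Let cM m n : c (m * n)%N = c m * c n. Proof. by case: hc. Qed.
Let c01 n : [\/ c n = 0, c n = 1 | c n = -1]. Proof. by case: hc. Qed.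
Let c1 : c 1%N = 1. Proof. by case: hc => _ _ _ _ []. Qed.

Let r0 n : (0 < n)%N -> 0 <= divsum c n.
Proof. exact: divsum_ge0. Qed.
Let rM n j : (0 < n)%N -> (0 < j)%N -> divsum c n <= divsum c (n * j ^ 2).
Proof. exact: divsum_mul_sqr. Qed.

Lemma expRN_le_inv_sqr (x : R) : 0 < x -> expR (- x) <= 2 / x ^+ 2.
Proof.
move=> x0; have := expR_ge1Dxn 1 (ltW x0); rewrite expRN => H.
rewrite -lef_pV2 ?posrE ?invr_gt0 ?divr_gt0 ?exprn_gt0 ?expR_gt0 //.
by rewrite invrK invf_div; move: H; rewrite (_ : 2`!%:R = 2 :> R) //; lra.
Qed.

Lemma smooth_weight_ge0 (h : R) n : 0 <= h -> 0 <= smooth_weight h n.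
Proof.
move=> h0; rewrite subr_ge0 ler_expR lerN2 ler_wpM2l //; lra.
Qed.

(** With t = k h in [1/4, 1] and e = e^(-t) in [1/4, 4/5], the weight is e (1 - e). *)
Lemma smooth_weight_dyadic (y k : nat) : (y < k <= 4 * y)%N ->
  1 / 20 <= smooth_weight ((4 * y%:R)^-1 : R) k.
Proof.
move=> /andP[yk ky]; have y0 : 0 < y%:R :> R by rewrite ltr0n; lia.
set t := k%:R * (4 * y%:R)^-1 : R.
have t4 : 1 / 4 <= t.
  rewrite /t ler_pdivlMr ?mulr_gt0 // mul1r mulrA mulVf // mul1r ler_nat; lia.
have t1 : t <= 1 by rewrite /t ler_pdivrMr ?mulr_gt0 // mul1r -natrM ler_nat.
rewrite /smooth_weight mulrCA -/t.
have -> : expR (- (2 * t)) = expR (- t) ^+ 2.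
  by rewrite expr2 -expRD; congr expR; ring.
have h1 : expR (- t) <= 4 / 5.
  rewrite expRN -lef_pV2 ?posrE ?invr_gt0 ?expR_gt0 // invrK.
  by have := expR_ge1Dx t; lra.
have h2 : 1 / 4 <= expR (- t).
  have -> : - t = - (t / 2) + - (t / 2) by field.
  rewrite expRD; have := expR_ge1Dx (- (t / 2)) => H.
  have : 1 / 2 <= expR (- (t / 2)) by lra.
  by move=> h; have := ler_pM _ _ h h; lra.
move: (expR _) h1 h2 => e h1 h2; rewrite expr2; nra.
Qed.

(** The smoothed sum over n <= D dominates the block and expands into 2y times the truncated L(1),
    the [bose_defect] sum and truncation errors; then D tends to infinity. *)
Lemma dyadic_divsum_le y : (0 < y)%N ->
  \sum_(y.+1 <= k < (4 * y).+1) divsum c k / 20 <=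
  2 * y%:R * L1 + 2 * (q%:R * Num.sqrt q%:R) / y%:R.
Proof.
move=> y0; have yR : 0 < y%:R :> R by rewrite ltr0n.
pose h : R := (4 * y%:R)^-1.
have h0 : 0 < h by rewrite invr_gt0 mulr_gt0.
rewrite -subr_le0.
(* The coefficients of 1/(D+1): 2y times the error 2q of L(1), the truncation in [sum_char_bose_le],
   and the D tails of the geometric sums. *)
pose K : R := 4 * q%:R * y%:R + 6 * (q%:R * Num.sqrt q%:R) / h + 16 / h ^+ 3.
apply: (@le0_of_le_div _ _ K (4 * y)) => D yD.
have DR : 0 < D%:R :> R by rewrite ltr0n; lia.
have step1 : \sum_(y.+1 <= k < (4 * y).+1) divsum c k / 20 <=
    \sum_(1 <= n < D.+1) divsum c n * smooth_weight h n.
  apply: (@le_trans _ _ (\sum_(y.+1 <= k < (4 * y).+1) divsum c k * smooth_weight h k)).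
    rewrite big_nat_cond [leRHS]big_nat_cond; apply: ler_sum => k /andP[yk _].
    rewrite ler_wpM2l ?r0 //; first by lia.
    by rewrite -[leLHS]mul1r; apply: smooth_weight_dyadic; lia.
  apply: ler_sum_subset; rewrite ?iota_uniq //.
    by move=> k; rewrite !mem_index_iota; lia.
  move=> k; rewrite mem_index_iota => /andP[k0 _].
  by rewrite mulr_ge0 ?r0 // smooth_weight_ge0 // ltW.
rewrite sum_divsum_weight in step1.
pose b d := bose_defect (d%:R * h) - bose_defect (d%:R * (2 * h)).
have err d : (1 <= d < D.+1)%N ->
  c d * (\sum_(1 <= m < (D %/ d).+1) smooth_weight h (d * m)) <=
  c d * ((2 * (d%:R * h))^-1 - b d) + 8 / (D%:R * h) ^+ 2 / h.
  move=> /andP[d0 dD].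
  have [e -> /andP[e0 eh]] := smooth_weight_multiples (D %/ d) h0 d0.
  rewrite [X in X <= _]mulrBr lerD2l.
  apply: (@le_trans _ _ e).
    apply: le_trans (ler_norm _) _; rewrite normrN normrM (ger0_norm e0).
    by rewrite -[leRHS]mul1r ler_wpM2r // (char_norm_le1 hc).
  apply: le_trans eh _; rewrite ler_wpM2r ?invr_ge0 ?(ltW h0) //.
  (* For d <= D, d times the integer part of D/d is at least D/2. *)
  apply: (@le_trans _ _ (expR (- (D%:R * h / 2)))).
    rewrite ler_expR lerN2 ler_pdivrMr // mulrAC ler_wpM2r ?(ltW h0) //.
    rewrite -natrM ler_nat.
    by have := divn_eq D d; have := ltn_pmod D d0; have := divn_gt0 D d0; nia.
  apply: le_trans (expRN_le_inv_sqr _) _; first by rewrite divr_gt0 ?mulr_gt0.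
  by rewrite le_eqVlt; apply/orP; left; apply/eqP; field; rewrite !gt_eqF.
have step2 : \sum_(1 <= d < D.+1) c d * (\sum_(1 <= m < (D %/ d).+1) smooth_weight h
  (d * m))
    <= \sum_(1 <= d < D.+1) (c d * ((2 * (d%:R * h))^-1 - b d) + 8 / (D%:R * h) ^+ 2
      / h).
  by rewrite big_nat_cond [leRHS]big_nat_cond; apply: ler_sum => d /andP[/err].
rewrite big_split /= sumr_const_nat subn1 /= in step2.
have main : \sum_(1 <= d < D.+1) c d * ((2 * (d%:R * h))^-1 - b d) =
    2 * y%:R * (\sum_(1 <= d < D.+1) c d / d%:R) - \sum_(1 <= d < D.+1) c d * b d.
  rewrite mulr_sumr -sumrB; apply: eq_big_nat => d /andP[d0 _].
  rewrite mulrBr; congr (_ - _); rewrite /h; field.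
  by rewrite !gt_eqF ?ltr0n.
have eb := sum_char_bose_le hc D h0; rewrite -/b in eb.
have eL := hL1 D.
have d0 : 8 / (D%:R * h) ^+ 2 / h *+ D <= 16 / h ^+ 3 / D.+1%:R.
  rewrite -mulr_natr (_ : _ * D%:R = 8 / h ^+ 3 / D%:R); last first.
    by field; rewrite !gt_eqF.
  rewrite (_ : 16 / h ^+ 3 / D.+1%:R = 8 / h ^+ 3 * (2 / D.+1%:R)); last by field;
    rewrite ?gt_eqF ?ltr0n.
  rewrite ler_wpM2l ?divr_ge0 ?exprn_ge0 ?(ltW h0) //.
  rewrite -[leLHS]mul1r ler_pdivrMr // mulrAC ler_pdivlMr ?ltr0n // mul1r.
  by rewrite -natrM ler_nat; lia.
have y2 : 0 <= 2 * y%:R :> R by rewrite mulr_ge0 // ltW.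
have := ler_wpM2l y2 (le_trans (ler_norm _) eL).
rewrite -normrN in eb; have := le_trans (ler_norm _) eb.
have hy : 8 * (q%:R * Num.sqrt q%:R) * h = 2 * (q%:R * Num.sqrt q%:R) / y%:R.
  by rewrite /h; field; rewrite gt_eqF.
rewrite hy /K.
move: step1 step2 d0; rewrite main.
rewrite [X in - X <= _](_ : _ = \sum_(1 <= d < D.+1) c d * b d) //.
set U := \sum_(_ <= _ < _) _; set V := \sum_(_ <= _ < _) _.
set S := \sum_(_ <= _ < _) _; set T := \sum_(_ <= _ < _) _.
move: (D.+1%:R^-1) (h^-1) ((h ^+ 3)^-1) (q%:R * Num.sqrt q%:R) (y%:R^-1) (8 / _ / _
  *+ _).
move=> x2 x3 x4 x5 x6 x1.
lra.
Qed.

Definition block_sum y : R := \sum_(y.+1 <= k < (4 * y).+1) divsum c k.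

(** The square class of 1 alone gives this much. *)
Lemma block_sum_ge_sqrt y : (0 < y)%N -> Num.sqrt y%:R / 2 <= block_sum y.
Proof.
move=> y0; have h14 : (1 <= 4 * y)%N by lia.
have := dyadic_class_ge (f := divsum c) (n := 1%N) isT h14 r0 rM.
rewrite divsum1 // mul1r sqrtr1 mulr1 => /le_trans; apply.
rewrite /block_sum [leRHS](bigID (fun k => sqfree_part k == sqfree_part 1%N)) /=.
by rewrite lerDl big_nat_cond sumr_ge0 // => k /andP[/andP[k0 _] _]; rewrite r0 //; lia.
Qed.

(** For y >= 64 q the error 2 q^(3/2) / y is at most sqrt y / 80, hence at most half of
    [block_sum y / 20] by the preceding lower bound, and is absorbed. *)
Lemma block_sum_le y : (64 * q <= y)%N -> block_sum y <= 80 * y%:R * L1.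
Proof.
move=> qy; have y0 : (0 < y)%N by lia.
have yR : 0 < y%:R :> R by rewrite ltr0n.
have qR : 0 < q%:R :> R by rewrite ltr0n.
have := dyadic_divsum_le y0; rewrite -mulr_suml -/(block_sum y).
have := block_sum_ge_sqrt y0.
suff : 2 * (q%:R * Num.sqrt q%:R) / y%:R <= Num.sqrt y%:R / 80 :> R by lra.
have s0 : 0 < Num.sqrt (q%:R : R) by rewrite sqrtr_gt0.
have sy : 8 * Num.sqrt q%:R <= Num.sqrt (y%:R : R).
  rewrite -[8]ger0_norm // -sqrtr_sqr -sqrtrM ?sqr_ge0 //; apply: ler_wsqrtr.
  by rewrite -natrX -natrM ler_nat.
have qy' : 64 * q%:R <= y%:R :> R by rewrite -natrM ler_nat.
rewrite ler_pdivrMr //.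
have := ler_pM _ _ qy' sy; nra.
Qed.

Lemma L1_ge y : (64 * q <= y)%N -> 1 <= 160 * Num.sqrt y%:R * L1.
Proof.
move=> qy; have y0 : (0 < y)%N by lia.
have sy0 : 0 < Num.sqrt (y%:R : R) by rewrite sqrtr_gt0 ltr0n.
have := le_trans (block_sum_ge_sqrt y0) (block_sum_le qy).
rewrite -{2}[y%:R](@sqr_sqrtr _ y%:R) ?ler0n // expr2.
rewrite (_ : 80 * _ * L1 = Num.sqrt y%:R / 2 * (160 * Num.sqrt y%:R * L1));
  last by field.
by rewrite -{1}[_ / 2]mulr1 ler_pM2l // divr_gt0.
Qed.

(** J = 0 is the square class bound. Passing from z to 4z adds a block on which 1/n <= 1/z, at a
    cost of 80 L(1), so the range can grow while [y] stays fixed. *)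
Lemma log_sum_divsum_le y J : (64 * q <= y)%N ->
  \sum_(1 <= n < (4 ^ J.+1 * y).+1) divsum c n / n%:R <=
  (160 * Num.sqrt y%:R * (\sum_(1 <= m < (4 * y).+1) m%:R^-1) + 80 * J%:R) * L1.
Proof.
move=> qy; have y0 : (0 < y)%N by lia.
have sy0 : 0 < Num.sqrt (y%:R : R) by rewrite sqrtr_gt0 ltr0n.
elim: J => [|J IH].
  rewrite mulr0 addr0 expn1; apply: le_trans (log_sum_le_dyadic y0 r0 rM) _.
  rewrite -/(block_sum y) [leRHS]mulrAC ler_wpM2r //.
    by rewrite sumr_ge0 // => m _; rewrite invr_ge0.
  apply: le_trans (ler_wpM2l _ (block_sum_le qy)) _; first by rewrite divr_ge0 // ltW.
  rewrite -{2}[y%:R](@sqr_sqrtr _ y%:R) ?ler0n //.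
  by rewrite le_eqVlt; apply/orP; left; apply/eqP; field; rewrite gt_eqF.
set z := (4 ^ J.+1 * y)%N in IH *.
have z0 : (0 < z)%N by rewrite muln_gt0 expn_gt0.
have zR : 0 < z%:R :> R by rewrite ltr0n.
have -> : (4 ^ J.+2 * y = 4 * z)%N by rewrite expnS mulnA.
rewrite (@big_cat_nat _ _ _ z.+1) //=; last by lia.
have qz : (64 * q <= z)%N by apply: leq_trans qy _; rewrite leq_pmull // expn_gt0.
have : \sum_(z.+1 <= n < (4 * z).+1) divsum c n / n%:R <= 80 * L1.
  apply: (@le_trans _ _ (block_sum z / z%:R)); last first.
    by rewrite ler_pdivrMr // mulrAC block_sum_le.
  rewrite /block_sum mulr_suml big_nat_cond [leRHS]big_nat_cond.
  apply: ler_sum => n /andP[/andP[zn _] _]; rewrite ler_wpM2l ?r0 //; first by lia.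
  by rewrite lef_pV2 ?posrE ?ltr0n ?ler_nat //; lia.
by rewrite -natr1; move: IH; lra.
Qed.
End Dyadic.

(** * L-series *)

Section PowerSums.
Variable R : realType.
Implicit Types s t b y : R.

Lemma powRN_le s t b : 0 <= b -> 0 < s -> s <= t -> t `^ (- b) <= s `^ (- b).
Proof.
move=> b0 s0 st; have t0 := lt_le_trans s0 st.
rewrite !powRN lef_pV2 ?posrE ?powR_gt0 //.
by apply: ge0_ler_powR => //; rewrite nnegrE ltW.
Qed.

Lemma powR_sub_mvt s t b : 0 <= b -> b != 1 -> 0 < s -> s <= t ->
  (t - s) * t `^ (- b) <= (t `^ (1 - b) - s `^ (1 - b)) / (1 - b) <=
  (t - s) * s `^ (- b).
Proof.
move=> b0 b1 s0; rewrite le_eqVlt => /orP[/eqP ->|st].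
  by rewrite !subrr !mul0r lexx.
have d0 : 1 - b != 0 by rewrite subr_eq0 eq_sym.
have dR (x : R) : 0 < x -> is_derive x 1 (fun y : R => y `^ (1 - b)) ((1 - b) * x `^
  (1 - b - 1)).
  by move=> x0; exact: is_derive1_powR.
have cR : {within `[s, t], continuous (fun y : R => y `^ (1 - b))}.
  apply: derivable_within_continuous => x; rewrite in_itv /= => /andP[sx _].
  by have := dR x (lt_le_trans s0 sx) => -[].
have dR' (x : R) : x \in `]s, t[ -> is_derive x 1 (fun y : R => y `^ (1 - b)) ((1 -
  b) * x `^ (1 - b - 1)).
  by rewrite in_itv /= => /andP[sx _]; apply: dR; apply: lt_trans sx.
have [x] := MVT st dR' cR; rewrite in_itv /= => /andP[sx xt] ->.
have ts : 0 <= t - s by lra.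
rewrite (_ : 1 - b - 1 = - b); last by ring.
rewrite (_ : _ / (1 - b) = (t - s) * x `^ (- b)); last by field.
rewrite !ler_wpM2l //; apply: powRN_le => //; try exact: ltW.
exact: lt_trans sx.
Qed.

(** Comparison with the integral of x^(-b) from [y] to [B]. A real endpoint [y] in [A, A+1] is
    allowed because the application has y = X / d and A its integer part. *)
Lemma sum_powRN_approx b (A B : nat) y : 0 <= b -> b != 1 -> (0 < A <= B)%N ->
  A%:R <= y <= A.+1%:R ->
  `|\sum_(A.+1 <= m < B.+1) m%:R `^ (- b) -
    (B%:R `^ (1 - b) - y `^ (1 - b)) / (1 - b)| <= A%:R `^ (- b).
Proof.
move=> b0 b1 /andP[A0 AB] /andP[Ay yA].
have AR : 0 < A%:R :> R by rewrite ltr0n.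
have y0 : 0 < y by apply: lt_le_trans Ay.
pose f x : R := x `^ (1 - b) / (1 - b).
have fI (s t : R) : (t `^ (1 - b) - s `^ (1 - b)) / (1 - b) = f t - f s by rewrite
  mulrBl.
have fm (s t : R) : 0 < s -> s <= t -> (t - s) * t `^ (- b) <= f t - f s <= (t - s) *
  s `^ (- b).
  by move=> s0 st; rewrite -fI powR_sub_mvt.
have up : \sum_(A.+1 <= m < B.+1) m%:R `^ (- b) <= f B%:R - f A%:R.
  rewrite -(@telescope_sumr _ A B (fun k => f k%:R)) // big_add1 /=.
  rewrite big_nat_cond [leRHS]big_nat_cond; apply: ler_sum => k /andP[/andP[Ak _] _].
  have k0 : 0 < k%:R :> R by rewrite ltr0n; lia.
  have := fm k%:R k.+1%:R k0; rewrite ler_nat leqnSn => /(_ isT)/andP[+ _].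
  by rewrite -{1}natr1 addrAC subrr add0r mul1r.
have dn : f B.+1%:R - f A.+1%:R <= \sum_(A.+1 <= m < B.+1) m%:R `^ (- b).
  rewrite -(@telescope_sumr _ A.+1 B.+1 (fun k => f k%:R)) //.
  rewrite big_nat_cond [leRHS]big_nat_cond; apply: ler_sum => k /andP[/andP[Ak _] _].
  have k0 : 0 < k%:R :> R by rewrite ltr0n; lia.
  have := fm k%:R k.+1%:R k0; rewrite ler_nat leqnSn => /(_ isT)/andP[_].
  by rewrite -{2}natr1 addrAC subrr add0r mul1r.
have /andP[_ e1] := fm _ _ AR Ay.
have /andP[_ e2] := fm _ _ y0 yA.
have B0 : 0 < B%:R :> R by rewrite ltr0n; lia.
have B1 : B%:R <= B.+1%:R :> R by rewrite ler_nat.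
have /andP[e3 _] := fm _ _ B0 B1.
have e4 : 0 <= (B.+1%:R - B%:R) * B.+1%:R `^ (- b).
  by rewrite mulr_ge0 ?powR_ge0 // subr_ge0.
have yb := powRN_le b0 AR Ay.
have Ab0 := powR_ge0 A%:R (- b); have yb0 := powR_ge0 y (- b).
have A1 : A.+1%:R = A%:R + 1 :> R by rewrite natr1.
have e5 : (y - A%:R) * A%:R `^ (- b) <= A%:R `^ (- b).
  by rewrite -[leRHS]mul1r ler_wpM2r //; lra.
have e6 : (A.+1%:R - y) * y `^ (- b) <= y `^ (- b).
  by rewrite -[leRHS]mul1r ler_wpM2r //; lra.
rewrite fI ler_norml; apply/andP; split; lra.
Qed.

End PowerSums.

(** * Convergence of the L-series at real points, and its product with zeta *)

Section LSeries.
Variables (R : realType) (q : nat) (c : nat -> R).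
Hypothesis hc : quadratic_character q c.

Let cD n : c (n + q)%N = c n. Proof. by case: hc. Qed.
Let c_sum : \sum_(0 <= n < q) c n = 0. Proof. by case: hc => _ _ _ _ []. Qed.
Let q0 : (0 < q)%N. Proof. by case: hc => _ _ _ _ []. Qed.

(** Full periods cancel, so a sum starting at 0 is at most q in size; a general interval is a
    difference of two such sums. *)
Lemma char_sum_le m n : `|\sum_(m <= d < n) c d| <= 2 * q%:R.
Proof.
have [mn|nm] := leqP m n; last by rewrite big_geq ?normr0 ?mulr_ge0 // ltnW.
pose S k := \sum_(0 <= d < k) c d.
have Sq k : `|S k| <= q%:R.
  have -> : S k = S (k %% q)%N.
    rewrite [in LHS](divn_eq k q); elim: (k %/ q)%N => [|j IH].
      by rewrite mul0n add0n.
    rewrite mulSn -addnA /S (@big_cat_nat _ _ _ q) ?leq_addr //= c_sum add0r.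
    rewrite -{1}[q]add0n big_addn addKn -[RHS]IH; apply: eq_bigr => i _; exact: cD.
  apply: le_trans (ler_norm_sum _ _ _) _.
  apply: (@le_trans _ _ (\sum_(0 <= d < k %% q) 1)).
    by apply: ler_sum => d _; exact: (char_norm_le1 hc).
  by rewrite sumr_const_nat subn0 ler_nat ltnW // ltn_pmod.
have -> : \sum_(m <= d < n) c d = S n - S m.
  by rewrite /S (@big_cat_nat _ _ _ m 0 n) //= addrAC subrr add0r.
by apply: le_trans (ler_normB _ _) _; have := Sq n; have := Sq m; lra.
Qed.

Definition Lsum (s : R) N := \sum_(1 <= d < N.+1) c d * d%:R `^ (- s).

Lemma Lsum_tail_le s N M : 0 <= s -> (N <= M)%N ->
  `|Lsum s M - Lsum s N| <= 2 * q%:R * N.+1%:R `^ (- s).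
Proof.
move=> s0 NM; rewrite /Lsum (@big_cat_nat _ _ _ N.+1 1 M.+1) //= addrAC subrr add0r.
apply: (abel_bound (v := fun d => d%:R `^ (- s))) => //.
- by move=> k Nk; apply: powRN_le; rewrite ?ltr0n ?ler_nat //; lia.
- by move=> k _; exact: char_sum_le.
Qed.

Lemma powRN_small (s e : R) : 0 < s -> 0 < e ->
  exists N : nat, N.+1%:R `^ (- s) < e.
Proof.
move=> s0 e0; exists (Num.bound (e^-1 `^ (s^-1))); set N := Num.bound _.
have ei0 : 0 < e^-1 by rewrite invr_gt0.
rewrite powRN -[ltRHS]invrK ltf_pV2 ?posrE ?powR_gt0 //.
rewrite -[ltLHS](@powRr1 _ e^-1) ?ltW // [X in _ `^ X < _](_ : _ = s^-1 * s).
  rewrite powRrM.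
  apply: gt0_ltr_powR; rewrite // ?nnegrE ?powR_ge0 //.
  apply: lt_le_trans (archi_boundP (powR_ge0 _ _)) _.
  by rewrite ler_nat.
by rewrite mulVf // gt_eqF.
Qed.

Lemma Lsum_cvg s : 0 < s ->
  exists2 l : R, Lsum s @ \oo --> l &
  forall N, `|Lsum s N - l| <= 2 * q%:R * N.+1%:R `^ (- s).
Proof.
move=> s0.
have cv : cvg (Lsum s @ \oo).
  apply/cauchy_cvgP/cauchy_exP => e e0.
  have e20 : 0 < e / (2 * q%:R) by rewrite divr_gt0 // mulr_gt0 // ltr0n.
  have [N hN] := powRN_small s0 e20.
  exists (Lsum s N); rewrite /fmapE -ball_normE /ball_ /=.
  exists N => //= M /= NM; rewrite distrC.
  apply: le_lt_trans (Lsum_tail_le (ltW s0) NM) _.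
  by move: hN; rewrite ltr_pdivlMr ?mulr_gt0 ?ltr0n // mulrC.
exists (lim (Lsum s @ \oo)) => // N.
have h : (fun M => `|Lsum s N - Lsum s M|) @ \oo --> `|Lsum s N - lim (Lsum s @ \oo)|.
  by apply: cvg_norm; apply: cvgB => //; exact: cvg_cst.
apply: (cvgr_to_le h); exists N => //= M /= NM.
by rewrite distrC Lsum_tail_le // ltW.
Qed.

Definition zsum (s : R) N := \sum_(1 <= m < N.+1) m%:R `^ (- s).

Lemma zsum_le s N M : (N <= M)%N -> zsum s N <= zsum s M.
Proof.
move=> NM; rewrite /zsum (@big_cat_nat _ _ _ N.+1 1 M.+1) //= lerDl.
by apply: sumr_ge0 => k _; exact: powR_ge0.
Qed.

Lemma zsum_ge0 s N : 0 <= zsum s N.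
Proof. by apply: sumr_ge0 => k _; exact: powR_ge0. Qed.

Definition divsum_zeta (s : R) N := \sum_(1 <= n < N.+1) divsum c n * n%:R `^ (- s).

(* The pole term of zeta is what survives when the L-series vanishes at [b]. *)
Lemma divsum_zeta_approx (b L1 : R) X Y : 0 < b -> b != 1 -> (0 < Y <= X)%N ->
  (forall N, `|Lsum b N| <= 2 * q%:R * N.+1%:R `^ (- b)) ->
  (forall N, `|\sum_(1 <= d < N.+1) c d / d%:R - L1| <= 2 * q%:R / N.+1%:R) ->
  `|divsum_zeta b X - X%:R `^ (1 - b) / (1 - b) * L1| <=
  4 * q%:R * Y%:R `^ (- b) * zsum b X +
  X%:R `^ (1 - b) / `|1 - b| * (2 * q%:R * Y%:R `^ (- b) + 2 * q%:R / Y%:R) +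
  Y%:R * (X%:R / 2) `^ (- b).
Proof.
move=> b0 b1 /andP[Y0 YX] hb hL1.
have YR : 0 < Y%:R :> R by rewrite ltr0n.
have XR : 0 < X%:R :> R by rewrite ltr0n; lia.
(* Grouping by n = d m leaves an inner sum over m <= X/d; the range of [d] is then cut at [Y]. *)
pose v d := d%:R `^ (- b) * zsum b (X %/ d).
have -> : divsum_zeta b X = \sum_(1 <= d < X.+1) c d * v d.
  rewrite /divsum_zeta (sum_divsum_weight c (fun n => n%:R `^ (- b))).
  apply: eq_bigr => d _; congr (_ * _); rewrite /v /zsum mulr_sumr.
  by apply: eq_bigr => m _; rewrite natrM powRM.
rewrite (@big_cat_nat _ _ _ Y.+1) //=.
(* [v] is nonincreasing, so summation by parts applies to the terms with d > Y. *)
have tail : `|\sum_(Y.+1 <= d < X.+1) c d * v d| <= 2 * q%:R * (Y%:R `^ (- b) * zsum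
  b X).
  apply: (@le_trans _ _ (2 * q%:R * v Y.+1)).
    apply: abel_bound => //.
    - move=> k Yk; apply: ler_pM; rewrite ?powR_ge0 ?zsum_ge0 //.
        by apply: powRN_le; rewrite ?ltr0n ?ler_nat // ?ltW //; lia.
      by apply: zsum_le; apply: leq_div2l => //; lia.
    - by move=> k _; rewrite mulr_ge0 ?powR_ge0 ?zsum_ge0.
    - by move=> k _; exact: char_sum_le.
  rewrite ler_wpM2l ?mulr_ge0 // ler_pM ?powR_ge0 ?zsum_ge0 //.
    by apply: powRN_le; rewrite ?(ltW b0) // ler_nat.
  by apply: zsum_le; apply: leq_div.
(* The error in replacing the zeta terms between X/d and X by an integral. *)
pose e d := \sum_((X %/ d).+1 <= m < X.+1) m%:R `^ (- b) -
    (X%:R `^ (1 - b) - (X%:R / d%:R) `^ (1 - b)) / (1 - b).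
have he d : (1 <= d < Y.+1)%N -> `|c d * d%:R `^ (- b) * e d| <= (X%:R / 2) `^ (- b).
  move=> /andP[d0 dY]; have dR : 0 < d%:R :> R by rewrite ltr0n.
  have Xd0 : (0 < X %/ d)%N by rewrite divn_gt0 //; lia.
  have ed : `|e d| <= (X %/ d)%:R `^ (- b).
    apply: sum_powRN_approx => //; first exact: ltW.
      by rewrite Xd0 leq_div.
    rewrite ler_pdivlMr // ler_pdivrMr // -!natrM !ler_nat.
    by have := divn_eq X d; have := ltn_pmod X d0; nia.
  rewrite -mulrA !normrM (ger0_norm (powR_ge0 _ _)).
  apply: (@le_trans _ _ (1 * (d%:R `^ (- b) * (X %/ d)%:R `^ (- b)))).
    apply: ler_pM; rewrite ?normr_ge0 ?mulr_ge0 ?powR_ge0 ?(char_norm_le1 hc) //.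
    by rewrite ler_wpM2l ?powR_ge0.
  rewrite mul1r -powRM // -natrM; apply: powRN_le; rewrite ?divr_gt0 //;
    first exact: ltW.
  rewrite ler_pdivrMr // -natrM ler_nat.
  by have := divn_eq X d; have := ltn_pmod X d0; nia.
(* Since d^(-b) (X/d)^(1-b) = X^(1-b) / d, the integrals produce the truncated L(1). The truncated
   L(b) is small because [hb] encodes L(b) = 0. *)
have head : \sum_(1 <= d < Y.+1) c d * v d =
   zsum b X * Lsum b Y
   - X%:R `^ (1 - b) / (1 - b) * (Lsum b Y - \sum_(1 <= d < Y.+1) c d / d%:R)
   - \sum_(1 <= d < Y.+1) c d * d%:R `^ (- b) * e d.
  rewrite /Lsum mulrBr !mulr_sumr -!sumrB; apply: eq_big_nat => d /andP[d0 dY].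
  have dR : 0 < d%:R :> R by rewrite ltr0n.
  rewrite /v /e /zsum (@big_cat_nat _ _ _ (X %/ d).+1 1 X.+1) //=; last first.
    by rewrite ltnS leq_div.
  have -> : (X%:R / d%:R) `^ (1 - b) = X%:R `^ (1 - b) * (d%:R^-1 / d%:R `^ (- b)) :> R.
    rewrite powRM ?invr_ge0 ?(ltW XR) ?(ltW dR) //; congr (_ * _).
    rewrite -(powR_inv1 (ltW dR)) -powRrM -powRB; last by apply/implyP => _;
      rewrite gt_eqF.
    by congr (_ `^ _); ring.
  have db : 0 < d%:R `^ (- b) by rewrite powR_gt0.
  have b10 : 1 - b != 0 by rewrite subr_eq0 eq_sym.
  by field; rewrite b10 !gt_eqF.
have E1 : `|\sum_(1 <= d < Y.+1) c d * d%:R `^ (- b) * e d| <= Y%:R * (X%:R / 2) `^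
  (- b).
  apply: le_trans (ler_norm_sum _ _ _) _.
  apply: (@le_trans _ _ (\sum_(1 <= d < Y.+1) (X%:R / 2) `^ (- b))).
    by rewrite big_nat_cond [leRHS]big_nat_cond; apply: ler_sum => d /andP[/he].
  by rewrite sumr_const_nat subn1 [leRHS]mulr_natl.
have hbY : `|Lsum b Y| <= 2 * q%:R * Y%:R `^ (- b).
  apply: le_trans (hb Y) _; rewrite ler_wpM2l ?mulr_ge0 //.
  by apply: powRN_le; rewrite ?(ltW b0) // ler_nat.
have hY1 : `|\sum_(1 <= d < Y.+1) c d / d%:R - L1| <= 2 * q%:R / Y%:R.
  apply: le_trans (hL1 Y) _; rewrite ler_wpM2l ?mulr_ge0 //.
  by rewrite lef_pV2 ?posrE ?ltr0n // ler_nat.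
have E2 : `|zsum b X * Lsum b Y| <= zsum b X * (2 * q%:R * Y%:R `^ (- b)).
  by rewrite normrM (ger0_norm (zsum_ge0 _ _)) ler_wpM2l ?zsum_ge0.
pose F := X%:R `^ (1 - b) / (1 - b).
have F1 : `|F| = X%:R `^ (1 - b) / `|1 - b|.
  by rewrite normrM normfV (ger0_norm (powR_ge0 _ _)).
have E3 : `|F * Lsum b Y| <= `|F| * (2 * q%:R * Y%:R `^ (- b)) by rewrite normrM
  ler_wpM2l.
set S1 := \sum_(1 <= d < Y.+1) c d / d%:R in hY1 head *.
have E4 : `|F * (S1 - L1)| <= `|F| * (2 * q%:R / Y%:R) by rewrite normrM ler_wpM2l.
rewrite head -F1 -/F.
set S2 := \sum_(_ <= _ < _) _ * _ * _; set S3 := \sum_(Y.+1 <= _ < _) _.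
rewrite (_ : _ - _ = zsum b X * Lsum b Y - F * Lsum b Y + F * (S1 - L1) - S2 + S3);
  last by ring.
move: tail E1; rewrite -/S2 -/S3 => E5 E6.
have := ler_normD (zsum b X * Lsum b Y - F * Lsum b Y + F * (S1 - L1) - S2) S3.
have := ler_normB (zsum b X * Lsum b Y - F * Lsum b Y + F * (S1 - L1)) S2.
have := ler_normD (zsum b X * Lsum b Y - F * Lsum b Y) (F * (S1 - L1)).
have := ler_normB (zsum b X * Lsum b Y) (F * Lsum b Y).
move: E2 E3 E4 E5 E6; lra.
Qed.

End LSeries.

(** * Real zeros *)

Section Zeros.
Variables (R : realType) (q : nat) (c : nat -> R).
Hypothesis hc : quadratic_character q c.

Let cM m n : c (m * n)%N = c m * c n. Proof. by case: hc. Qed.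
Let c01 n : [\/ c n = 0, c n = 1 | c n = -1]. Proof. by case: hc. Qed.
Let q0 : (0 < q)%N. Proof. by case: hc => _ _ _ _ []. Qed.
Let c1 : c 1%N = 1. Proof. by case: hc => _ _ _ _ []. Qed.
Let r0 n : (0 < n)%N -> 0 <= divsum c n.
Proof. exact: divsum_ge0. Qed.

Lemma harmonic_sum_le N : (0 < N)%N ->
  \sum_(1 <= m < N.+1) (m%:R : R)^-1 <= 1 + ln (N%:R : R).
Proof.
case: N => // N _; elim: N => [|N IH]; first by rewrite big_nat1 ln1 invr1 addr0.
rewrite big_nat_recr //=.
have N2 : 0 < N.+2%:R :> R by rewrite ltr0n.
have N1 : 0 < N.+1%:R :> R by rewrite ltr0n.
have h : -1 < - (N.+2%:R^-1 : R).
  by rewrite ltrN2 invf_lt1 // ltr1n.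
have := le_ln1Dx h.
have -> : 1 + - N.+2%:R^-1 = N.+1%:R / N.+2%:R :> R.
  rewrite -[N.+2%:R]natr1; move: (N.+1%:R) N1 => x x0; field.
  by apply: lt0r_neq0; lra.
rewrite ln_div ?posrE //; move: IH.
by move: (\sum_(_ <= _ < _) _) (ln _) (ln _) (N.+2%:R^-1) => S u v w; lra.
Qed.

Lemma divsum_zeta_ge1 b N : (0 < N)%N -> 1 <= divsum_zeta c b N.
Proof.
move=> N0; rewrite /divsum_zeta big_ltn ?ltnS // divsum1 // mul1r powR1 lerDl.
rewrite big_nat_cond sumr_ge0 // => k /andP[/andP[k0 _] _].
by rewrite mulr_ge0 ?powR_ge0 // r0 //; lia.
Qed.

Variable L1 : R.
Hypothesis hL1 : forall N,
  `|\sum_(1 <= d < N.+1) c d / d%:R - L1| <= 2 * q%:R / N.+1%:R.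

Lemma L1_gt0 : 0 < L1.
Proof.
have h := L1_ge hc hL1 (leqnn (64 * q)%N).
have s0 : 0 < 160 * Num.sqrt (64 * q)%:R :> R by rewrite mulr_gt0 // sqrtr_gt0 ltr0n;
  lia.
by rewrite -(pmulr_rgt0 L1 s0); exact: lt_le_trans ltr01 h.
Qed.

(** For b > 1 the pole term X^(1-b) L(1) / (1 - b) is nonpositive, whereas the sum that it
    approximates is at least 1. *)
Lemma Lsum_no_zero_gt1 (b : R) : 1 < b ->
  ~ (forall N, `|Lsum c b N| <= 2 * q%:R * N.+1%:R `^ (- b)).
Proof.
move=> b1 hb.
have q0R : 0 <= q%:R :> R by [].
set t := b - 1; have t0 : 0 < t by rewrite subr_gt0.
have nt : `|1 - b| = t by rewrite distrC ger0_norm // ltW.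
have inv_le (x : R) : 1 <= x -> x `^ (- b) <= x^-1.
  move=> x1; rewrite -powR_inv1; last by lra.
  by apply: ler_powR => //; lra.
pose K : R := 4 * q%:R * (2 + t^-1) + 4 * q%:R / t + 2.
suff : 1 <= 0 :> R by lra.
apply: (@le0_of_le_div _ _ K 1) => D D1.
(* With X = Y^2 every error is O(1/Y); in particular Y (X/2)^(-b) <= 2/Y. *)
set Y := D.+1; pose X := (Y * Y)%N.
have YR : 2 <= Y%:R :> R by rewrite ler_nat.
have XE : X%:R = Y%:R * Y%:R :> R by rewrite natrM.
have XR : 4 <= X%:R :> R by rewrite XE; have := ler_pM _ _ YR YR; lra.
have Z : zsum b X <= 2 + t^-1.
  rewrite /zsum big_ltn ?ltnS ?muln_gt0 // powR1.
  have H' : `|\sum_(2 <= m < X.+1) m%:R `^ (- b) - (X%:R `^ (1 - b) - 1) / (1 - b)|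
    <= 1.
    have b0 : 0 <= b by lra.
    have X0 : (0 < 1 <= X)%N by rewrite muln_gt0.
    have y1 : (1%N%:R : R) <= 1 <= (2%N%:R : R) by rewrite lexx ler1n.
    by have := sum_powRN_approx b0 (negbT (gt_eqF b1)) X0 y1; rewrite !powR1.
  have := le_trans (ler_norm _) H'.
  have -> : (X%:R `^ (1 - b) - 1) / (1 - b) = t^-1 - X%:R `^ (1 - b) / t.
    by rewrite /t; field; rewrite -/t gt_eqF // subr_eq0 lt_eqF.
  have : 0 <= X%:R `^ (1 - b) / t by rewrite divr_ge0 ?powR_ge0 // ltW.
  lra.
have X1 : X%:R `^ (1 - b) <= 1.
  by rewrite -[leRHS](powRr0 X%:R); apply: ler_powR; lra.
have Yb : Y%:R `^ (- b) <= Y%:R^-1 by apply: inv_le; lra.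
have Xb : (X%:R / 2) `^ (- b) <= (X%:R / 2)^-1 by apply: inv_le; lra.
have L10 := L1_gt0.
have YX : (0 < Y <= X)%N by rewrite leq_pmulr.
have b0 : 0 < b by lra.
have := divsum_zeta_approx hc b0 (negbT (gt_eqF b1)) YX hb hL1.
rewrite nt => /(le_trans (ler_norm _)).
have X00 : (0 < X)%N by rewrite muln_gt0.
have T1 := divsum_zeta_ge1 b X00.
have main : X%:R `^ (1 - b) / (1 - b) * L1 <= 0.
  rewrite mulr_le0_ge0 // ?(ltW L10) // mulr_ge0_le0 ?powR_ge0 // invr_le0; lra.
have Yi : 0 < Y%:R^-1 :> R by rewrite invr_gt0; lra.
have e1 : 4 * q%:R * Y%:R `^ (- b) * zsum b X <= 4 * q%:R * Y%:R^-1 * (2 + t^-1).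
  by rewrite ler_pM ?zsum_ge0 ?mulr_ge0 ?powR_ge0 // ler_wpM2l // mulr_ge0.
have e2 : X%:R `^ (1 - b) / t * (2 * q%:R * Y%:R `^ (- b) + 2 * q%:R / Y%:R) <=
    1 / t * (4 * q%:R / Y%:R).
  have Yb0 := powR_ge0 Y%:R (- b).
  apply: ler_pM; first by rewrite divr_ge0 ?powR_ge0 ?(ltW t0).
  - by rewrite addr_ge0 // mulr_ge0 // ?mulr_ge0 // ltW.
  - by rewrite ler_wpM2r // invr_ge0 ltW.
  - by have := ler_wpM2l q0R Yb; lra.
have e3 : Y%:R * (X%:R / 2) `^ (- b) <= 2 / Y%:R.
  apply: (@le_trans _ _ (Y%:R * (X%:R / 2)^-1)); first by rewrite ler_wpM2l.
  rewrite XE le_eqVlt; apply/orP; left; apply/eqP; field; apply: lt0r_neq0; lra.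
rewrite /K; move: e1 e2 e3 main T1.
move: (divsum_zeta _ _ _) (X%:R `^ (1 - b) / (1 - b) * L1) => T F.
move: (4 * q%:R * Y%:R `^ (- b) * zsum b X) (X%:R `^ _ / t * _) (Y%:R * _ `^ _) => z1
  z2 z3.
lra.
Qed.

Lemma powR_le2 (d X x : R) : 0 <= d -> 0 < x -> x <= X -> d * ln X <= 1 / 2 -> x `^ d
  <= 2.
Proof.
move=> d0 x0 xX dX; have X0 := lt_le_trans x0 xX.
apply: (@le_trans _ _ (X `^ d)).
  by apply: ge0_ler_powR => //; rewrite nnegrE ltW.
rewrite /powR gt_eqF //; apply: (@le_trans _ _ (expR (1 / 2)));
  first by rewrite ler_expR.
rewrite -lef_pV2 ?posrE ?expR_gt0 // -expRN.
by have := expR_ge1Dx (- (1 / 2) : R); lra.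
Qed.

Lemma powRN_div (x b : R) : 0 < x -> x `^ (- b) = x `^ (1 - b) / x.
Proof.
move=> x0; rewrite -[X in _ / X](powRr1 (ltW x0)) -powRB.
  by congr (_ `^ _); ring.
by apply/implyP => _; rewrite gt_eqF.
Qed.

Lemma divsum_zeta_le (b : R) N : b <= 1 ->
  divsum_zeta c b N <=
  N%:R `^ (1 - b) * \sum_(1 <= n < N.+1) divsum c n / n%:R.
Proof.
move=> b1; rewrite /divsum_zeta mulr_sumr big_nat_cond [leRHS]big_nat_cond.
apply: ler_sum => n /andP[/andP[n0 nN] _].
have nR : 0 < n%:R :> R by rewrite ltr0n.
rewrite mulrCA ler_wpM2l ?r0 //.
rewrite powRN_div // ler_wpM2r ?invr_ge0 ?(ltW nR) //.
by apply: ge0_ler_powR; rewrite ?nnegrE ?subr_ge0 // ler_nat.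
Qed.

Lemma zsum_le_harmonic (b : R) N : (0 < N)%N -> b <= 1 ->
  zsum b N <= N%:R `^ (1 - b) * (1 + ln (N%:R : R)).
Proof.
move=> N0 b1; apply: le_trans (ler_wpM2l (powR_ge0 _ _) (harmonic_sum_le N0)).
rewrite /zsum mulr_sumr big_nat_cond [leRHS]big_nat_cond.
apply: ler_sum => n /andP[/andP[n0 nN] _].
have nR : 0 < n%:R :> R by rewrite ltr0n.
rewrite powRN_div // ler_wpM2r ?invr_ge0 ?(ltW nR) //.
by apply: ge0_ler_powR; rewrite ?nnegrE ?subr_ge0 // ler_nat.
Qed.

(** [J] is the integer part of [t] plus 1, and e <= 4 follows from e^(1/2) <= 2. *)
Lemma exists_exponent (t : R) : 0 <= t ->
  exists2 J : nat, expR t <= (4 ^ J)%:R :> R & J%:R <= t + 1.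
Proof.
move=> t0; exists (Num.truncn t).+1; last first.
  by rewrite -natr1 lerD2r truncn_le.
rewrite natrX; apply: (@le_trans _ _ (expR (1 : R) ^+ (Num.truncn t).+1)).
  by rewrite -expRM_natl mulr1 ler_expR ltW // truncnS_gt.
apply: lerXn2r; rewrite ?nnegrE ?expR_ge0 //.
have := expR_ge1Dx (- (1 / 2) : R); rewrite expRN => H.
have e0 := expR_gt0 (1 / 2 : R).
have e2 : expR (1 / 2 : R) <= 2.
  by rewrite -lef_pV2 ?posrE //; lra.
rewrite (_ : 1 = 1 / 2 + 1 / 2); last by field.
by rewrite expRD; have := ler_pM (ltW e0) (ltW e0) e2 e2; lra.
Qed.

End Zeros.

(** * Distance of a real zero from 1 *)

Section ZeroBound.
Variables (R : realType) (q : nat) (c : nat -> R).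
Hypothesis hc : quadratic_character q c.

Let q0 : (0 < q)%N. Proof. by case: hc => _ _ _ _ []. Qed.

(** The approximation gives F <= T + 1/4 + F/2 + 1/4 with F = P L(1) / t, hence F <= 3T as T >= 1.
    The logarithmic sum bounds T by P L(1) times O(sqrt q log q), and P L(1) cancels. *)
Lemma zero_gap (L1 b : R) :
  (forall N, `|\sum_(1 <= d < N.+1) c d / d%:R - L1| <= 2 * q%:R / N.+1%:R) ->
  0 < b < 1 ->
  (forall N, `|Lsum c b N| <= 2 * q%:R * N.+1%:R `^ (- b)) ->
  10 ^+ 5 <= ln (q%:R : R) -> (1 - b) * (12 * ln q%:R) <= 1 / 2 ->
  1 <= 24 * 360 * (1 - b) * (Num.sqrt q%:R * ln q%:R).
Proof.
move=> hL1 /andP[b0 b1] hb; set l := ln q%:R => l1; set t := 1 - b => tl.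
have t0 : 0 < t by rewrite subr_gt0.
pose Q : R := q%:R; pose s : R := Num.sqrt Q.
have Q0 : 0 < Q by rewrite ltr0n.
have lQ : l < Q by exact: ln_sublinear.
have s0 : 0 < s by rewrite sqrtr_gt0.
have s2 : s ^+ 2 = Q by rewrite sqr_sqrtr // ltW.
have s1 : 1 <= s.
  by rewrite -sqrtr1; apply: ler_wsqrtr; rewrite ler1n.
have sQ : s <= Q by rewrite -s2 expr2 -[leLHS]mul1r ler_wpM2r // ltW.
have l3 : 0 <= 3%:R * l by lra.
(* 4^J >= q^3 makes X at least 256 q^4, while log X stays below 12 log q. *)
have [J QJ Jl] := exists_exponent l3.
have {}QJ : Q ^+ 3 <= (4 ^ J)%:R.
  by rewrite -[Q](@lnK R) ?posrE // -expRM_natl.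
set y := (64 * q)%N; set X := (4 ^ J.+1 * y)%N.
have y0 : (0 < y)%N by rewrite muln_gt0.
have X0 : (0 < X)%N by rewrite muln_gt0 expn_gt0.
have XR0 : 0 < X%:R :> R by rewrite ltr0n.
have ln4 : ln (4 : R) <= 3.
  have h : -1 < 3 :> R by lra.
  by have := le_ln1Dx h; rewrite (_ : 1 + 3 = 4 :> R) //; ring.
have XE : X%:R = 4 ^+ (J + 4) * Q :> R.
  by rewrite /X /y -!natrX -natrM; congr (_%:R); rewrite expnD mulnA;
    congr (_ * _)%N; rewrite expnS; ring.
have lnX : ln (X%:R : R) <= 12 * l.
  (* With J <= 3l + 1 and ln 4 <= 3, the sum (J + 4) ln 4 + l is at most 10 l + 15. *)
  rewrite XE lnM ?posrE ?exprn_gt0 // lnXn // -/l -[ln 4 *+ _]mulr_natl natrD.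
  have : (J%:R + 4%:R) * ln 4 <= (J%:R + 4%:R) * 3 :> R.
    by rewrite ler_wpM2l // addr_ge0.
  lra.
have XQ : 256 * Q ^+ 4 <= X%:R.
  rewrite XE addnC exprD -natrX (_ : (4 : R) ^+ J = (4 ^ J)%:R); last by rewrite natrX.
  rewrite [Q ^+ 4]exprSr mulrA ler_pM2r //.
  rewrite (_ : 256 = 4 ^+ 4 :> R); last by rewrite -natrX.
  by rewrite ler_wpM2l.
have XR : 0 <= X%:R :> R by exact: ltW.
(* With Y = q^3 the errors q Y^(-b) are O(q^(-2)), small against both 1 / log q and the lower bound
   for L(1). *)
pose Y := (q ^ 3)%N.
have YE : Y%:R = Q ^+ 3 :> R by rewrite natrX.
have YR : 0 < Y%:R :> R by rewrite YE exprn_gt0.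
have Q1 : 10 ^+ 5 <= Q by lra.
have Q34 : Q ^+ 3 <= Q ^+ 4 by rewrite [leRHS]exprSr ler_peMr ?exprn_ge0 //; lra.
have YX : (0 < Y <= X)%N.
  rewrite expn_gt0 q0 /= -(ler_nat R) YE; apply: le_trans XQ.
  have : 0 <= Q ^+ 4 by rewrite exprn_ge0 // ltW.
  lra.
have tX : t * ln X%:R <= 1 / 2.
  by apply: le_trans tl; rewrite ler_wpM2l // ltW.
have le2 x : 0 < x -> x <= X%:R -> x `^ t <= 2.
  by move=> x0 xX; apply: powR_le2 tX; rewrite // ltW.
have Yb : Y%:R `^ (- b) <= 2 / Y%:R.
  rewrite powRN_div // ler_wpM2r ?invr_ge0 ?(ltW YR) // le2 // ler_nat.
  by case/andP: YX.
have Xb : (X%:R / 2) `^ (- b) <= 4 / X%:R.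
  have X2 : 0 < X%:R / 2 :> R by rewrite divr_gt0.
  rewrite powRN_div // (_ : 4 / _ = 2 / (X%:R / 2)); last by field; rewrite gt_eqF.
  by rewrite ler_wpM2r ?invr_ge0 ?(ltW X2) // le2 //; lra.
set P := X%:R `^ t; have P2 : P <= 2 by apply: le2.
have P0 : 0 < P by rewrite powR_gt0.
have Zb : zsum b X <= 2 * (1 + 12 * l).
  apply: le_trans (zsum_le_harmonic X0 (ltW b1)) _.
  apply: ler_pM; rewrite ?powR_ge0 ?addr_ge0 ?ln_ge0 ?ler1n //.
  by rewrite lerD2l.
have L10 := L1_gt0 hc hL1.
have L1s : 1 <= 8 * 160 * s * L1.
  have := L1_ge hc hL1 (leqnn (64 * q)%N).
  rewrite natrM sqrtrM // (_ : 64%:R = 8 ^+ 2 :> R); last by rewrite -natrX.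
  rewrite sqrtr_sqr ger0_norm //; rewrite -/Q -/s; lra.
set T := divsum_zeta c b X.
have T1 : 1 <= T by exact: (divsum_zeta_ge1 hc).
pose F := P / t * L1.
have F0 : 0 < F by rewrite !mulr_gt0 // invr_gt0.
have := divsum_zeta_approx hc b0 (negbT (lt_eqF b1)) YX hb hL1.
rewrite -/t -/P -/F -/T -/Q (ger0_norm (ltW t0)) distrC.
move=> /(le_trans (ler_norm _)) approx.
have Q3 : 0 < Q ^+ 3 by rewrite exprn_gt0.
have QQ : 10 ^+ 5 * Q <= Q ^+ 2 by rewrite expr2 ler_wpM2r // ltW.
have e1 : 4 * Q * Y%:R `^ (- b) * zsum b X <= 1 / 4.
  apply: (@le_trans _ _ (4 * Q * (2 / Y%:R) * (2 * (1 + 12 * l)))).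
    apply: ler_pM; rewrite ?zsum_ge0 //.
      by rewrite mulr_ge0 ?powR_ge0 // mulr_ge0 // ltW.
    by rewrite ler_wpM2l // mulr_ge0 // ltW.
  rewrite YE (_ : _ * _ = 16 * (1 + 12 * l) / Q ^+ 2); last first.
    by field; rewrite gt_eqF.
  rewrite ler_pdivrMr ?exprn_gt0 //; lra.
have e2 : P / t * (2 * Q * Y%:R `^ (- b) + 2 * Q / Y%:R) <= F / 2.
  rewrite /F -[X in _ <= X]mulrA ler_wpM2l ?divr_ge0 ?(ltW P0) ?(ltW t0) //.
  apply: (@le_trans _ _ (6 * (Q / Y%:R))).
    have Q2 : 0 <= 2 * Q by lra.
    by have := ler_wpM2l Q2 Yb; lra.
  rewrite YE (_ : Q / Q ^+ 3 = (Q ^+ 2)^-1); last by field; rewrite gt_eqF.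
  rewrite ler_pdivrMr ?exprn_gt0 //.
  have : s * L1 <= Q * L1 by rewrite ler_wpM2r // ltW.
  have : 10 ^+ 5 * Q * L1 <= Q ^+ 2 * L1 by rewrite ler_wpM2r // ltW.
  lra.
have e3 : Y%:R * (X%:R / 2) `^ (- b) <= 1 / 4.
  apply: (@le_trans _ _ (Y%:R * (4 / X%:R))); first by rewrite ler_wpM2l // ltW.
  by rewrite mulrA ler_pdivrMr // YE; lra.
have FT : F <= 3 * T by lra.
have TS := divsum_zeta_le hc X (ltW b1).
rewrite -/t -/P -/T in TS.
have SL := log_sum_divsum_le hc hL1 J (leqnn (64 * q)%N).
rewrite -/y -/X in SL.
have H : \sum_(1 <= m < (4 * y).+1) (m%:R : R)^-1 <= 2 * l.
  apply: le_trans (harmonic_sum_le _ _) _; first by rewrite muln_gt0.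
  rewrite /y mulnA natrM (_ : (4 * 64)%:R = 4 ^+ 4 :> R); last by rewrite -natrX.
  rewrite lnM ?posrE ?exprn_gt0 // lnXn // -[ln 4 *+ _]mulr_natl -/l; lra.
have sy : Num.sqrt (y%:R : R) = 8 * s.
  rewrite /y natrM sqrtrM // (_ : 64%:R = 8 ^+ 2 :> R); last by rewrite -natrX.
  by rewrite sqrtr_sqr ger0_norm.
rewrite sy in SL.
have sl : l <= s * l by rewrite ler_peMl //; lra.
(* The first part is at most 2560 s l, and 80 J <= 240 l + 80 fits in the remaining 320 s l. *)
have key : 160 * (8 * s) * (\sum_(1 <= m < (4 * y).+1) (m%:R : R)^-1) + 80 * J%:R
    <= 8 * 360 * (s * l).
  have s8 : 0 <= 160 * (8 * s) by lra.
  have := ler_wpM2l s8 H; lra.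
have PS : F <= 3 * (P * (8 * 360 * (s * l) * L1)).
  apply: le_trans FT _; rewrite ler_wpM2l //; apply: le_trans TS _.
  rewrite ler_wpM2l ?(ltW P0) //; apply: le_trans SL _.
  by rewrite ler_wpM2r // ltW.
move: PS; rewrite /F (_ : P / t * L1 = P * L1 * t^-1); last by ring.
rewrite (_ : 3 * _ = P * L1 * (24 * 360 * (s * l))); last by ring.
rewrite ler_pM2l ?mulr_gt0 // -(ler_pM2l t0) divff ?gt_eqF // -/s => h.
by apply: le_trans h _; rewrite le_eqVlt; apply/orP; left; apply/eqP;
  rewrite -/Q -/s; ring.
Qed.

(** If the bound failed, (1 - b) sqrt q l^2 < 12800; then [zero_gap] applies and gives l < 8640 *
    12800, contradicting l >= 10^9. The points b = 1 and b > 1 are excluded by L(1) > 0 and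
    [Lsum_no_zero_gt1]. *)
Lemma real_zero_le (b : R) :
  10 ^+ 9 <= ln (q%:R : R) -> 0 < b -> Lsum c b @ \oo --> (0 : R) ->
  b <= 1 - 128 * 100 / (Num.sqrt q%:R * ln q%:R ^+ 2).
Proof.
set l := ln q%:R => l9 b0 bz.
have l10 : 10 ^+ 9 <= l by [].
have [L1 L1c hL1'] := Lsum_cvg hc (ltr01 : 0 < 1 :> R).
have hL1 N : `|\sum_(1 <= d < N.+1) c d / d%:R - L1| <= 2 * q%:R / N.+1%:R.
  have := hL1' N; rewrite /Lsum powR_inv1 //.
  by under eq_bigr do rewrite powR_inv1 //.
have [l2 l2c hb] := Lsum_cvg hc b0.
have l20 : l2 = 0 by exact: (cvg_unique (@Rhausdorff R) l2c bz).
rewrite {}l20 {l2c} in hb.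
have {}hb N : `|Lsum c b N| <= 2 * q%:R * N.+1%:R `^ (- b) by rewrite -[Lsum _ _
  _]subr0.
have L10 := L1_gt0 hc hL1.
rewrite leNgt; apply/negP => hlt.
have [b1|b1|b1] := ltrgtP b 1; first last.
- rewrite b1 in bz; move: L10.
  by rewrite (cvg_unique (@Rhausdorff R) L1c bz) ltxx.
- exact: (Lsum_no_zero_gt1 hc hL1 b1 hb).
have l0 : 0 < l by apply: lt_le_trans l10; rewrite exprn_gt0.
have s1 : 1 <= Num.sqrt q%:R :> R.
  by rewrite -[leLHS]sqrtr1; apply: ler_wsqrtr; rewrite ler1n.
have s0 : 0 < Num.sqrt q%:R :> R by lra.
have d1 : (1 - b) * (Num.sqrt q%:R * l ^+ 2) < 128 * 100.
  by rewrite -ltr_pdivlMr ?mulr_gt0 ?exprn_gt0 //; lra.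
have b10 : 0 < 1 - b by lra.
have d2 : (1 - b) * l ^+ 2 < 128 * 100.
  apply: le_lt_trans d1; rewrite ler_wpM2l ?(ltW b10) // ler_peMl //.
  by rewrite exprn_ge0 // ltW.
have := @zero_gap L1 b hL1 _ hb _ _; rewrite b0 b1 -/l => /(_ isT) gap.
have c1' : 10 ^+ 5 <= l by lra.
have c2 : (1 - b) * (12 * l) <= 1 / 2.
  rewrite -(ler_pM2r l0); apply: (@le_trans _ _ (12 * ((1 - b) * l ^+ 2))).
    by rewrite expr2; lra.
  lra.
have := gap c1' c2; rewrite -(ler_pM2r l0).
rewrite [leRHS](_ : _ = 24 * 360 * ((1 - b) * (Num.sqrt q%:R * l ^+ 2))); last by ring.
lra.
Qed.
End ZeroBound.

(** * Real Dirichlet characters *)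

Section RealDirichletCharacter.
Variables (R : realType) (q : nat) (chi : int -> R[i]).
Hypotheses (q0 : (0 < q)%N) (hchi : dirichlet_character q chi).
Hypotheses (hnp : chi <> @principal_character R q) (hreal : real_character chi).

Definition real_values (n : nat) : R := complex.Re (chi n%:Z).
Local Notation c := real_values.

Let chiD m : chi (m + q%:Z) = chi m. Proof. by case: hchi. Qed.
Let chiM m n : chi (m * n) = chi m * chi n. Proof. by case: hchi. Qed.
Let chi_coprime m : chi m != 0 <-> coprimez m q. Proof. by case: hchi. Qed.

Lemma real_valuesE n : chi n%:Z = (c n)%:C%C.
Proof. by rewrite RRe_real // hreal. Qed.

Let c_inj n (x : R) : chi n%:Z = x%:C%C -> c n = x.
Proof. by rewrite /real_values => ->. Qed.

Lemma real_valuesM m n : c (m * n)%N = c m * c n.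
Proof. by apply: c_inj; rewrite PoszM chiM !real_valuesE rmorphM. Qed.

Lemma real_valuesD n : c (n + q)%N = c n.
Proof. by apply: c_inj; rewrite PoszD chiD real_valuesE. Qed.

Lemma real_values1 : c 1%N = 1.
Proof.
apply: c_inj; have h : chi 1 != 0 by apply/chi_coprime; rewrite coprimezE coprime1n.
by apply: (mulfI h); rewrite -chiM mulr1 mulr1.
Qed.

Lemma real_values_coprime n : (c n != 0) = coprime n q.
Proof.
have -> : (c n != 0) = (chi n%:Z != 0) by rewrite real_valuesE fmorph_eq0.
by apply/idP/idP => [/chi_coprime|h]; [|apply/chi_coprime]; rewrite coprimezE.
Qed.

Lemma real_values_modn n : c (n %% q)%N = c n.
Proof.
rewrite [in RHS](divn_eq n q) addnC; elim: (n %/ q)%N => [|k IH].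
  by rewrite mul0n addn0.
by rewrite mulSn addnCA addnC real_valuesD.
Qed.

Lemma real_valuesX n k : c (n ^ k)%N = c n ^+ k.
Proof.
elim: k => [|k IH]; first by rewrite expn0 expr0 real_values1.
by rewrite expnS exprS real_valuesM IH.
Qed.

(** Euler's theorem gives c(n)^phi(q) = 1 for n coprime to q, and a real number with this property
    has absolute value 1. *)
Lemma real_values_trichotomy n : [\/ c n = 0, c n = 1 | c n = -1].
Proof.
have [->|] := eqVneq (c n) 0; first by constructor 1.
rewrite real_values_coprime => nq.
have : `|c n| == 1.
  have tq : (0 < totient q)%N by rewrite totient_gt0.
  rewrite -(pexpr_eq1 tq) ?normr_ge0 // -normrX -real_valuesX -real_values_modn.
  by rewrite Euler_exp_totient // real_values_modn real_values1 normr1.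
by rewrite eqr_norml ler01 andbT => /orP[] /eqP ->; [constructor 2 | constructor 3].
Qed.

(** Otherwise [chi] is 1 at all integers coprime to q, which makes it principal. *)
Lemma exists_value_neq1 : exists2 b, coprime b q & c b != 1.
Proof.
apply: contrapT => H; apply: hnp; apply/funext => m.
have per (k : nat) m' : chi (m' + k%:Z * q%:Z) = chi m'.
  elim: k => [|k IH]; first by rewrite mul0r addr0.
  by rewrite intS mulrDl mul1r addrCA addrC chiD.
(* Each integer is congruent to a natural number, where [c] carries the values of [chi]. *)
have [r rE] : exists r : nat, chi m = chi r%:Z.
  have qz : q%:Z != 0 by rewrite -lt0n.
  have := modz_ge0 m qz; have := divz_eq m q%:Z.
  case: (m %% q%:Z)%Z => // r + _; exists r.
  move: H0 => ->.
  case: (m %/ q%:Z)%Z => n; first by rewrite addrC per.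
  by rewrite -(per n.+1) NegzE addrAC mulNr addNr add0r.
rewrite /principal_character.
have cr : coprimez m q = coprime r q.
  apply/idP/idP => [/chi_coprime|h]; last apply/chi_coprime; rewrite rE.
    by move/chi_coprime; rewrite coprimezE.
  by apply/chi_coprime; rewrite coprimezE.
rewrite cr rE real_valuesE; case: (boolP (coprime r q)) => rq.
  have [->|c1'] := eqVneq (c r) 1; first by [].
  by case: H; exists r.
by move: rq; rewrite -real_values_coprime negbK => /eqP ->.
Qed.

(** Multiplying the sum over a period by a value c(b) different from 1 only permutes its terms, so
    the sum vanishes. *)
Lemma quadratic_real_values : quadratic_character q c.
Proof.
split; [exact: real_valuesD | exact: real_valuesM | exact: real_values_trichotomy | |].
  by move=> n; rewrite real_values_coprime.
split=> //; first exact: real_values1.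
have [b bq cb] := exists_value_neq1.
have E : c b * (\sum_(0 <= n < q) c n) = \sum_(0 <= n < q) c n.
  rewrite -[RHS](sum_coprime_reindex c q0 bq) mulr_sumr.
  by apply: eq_bigr => m _; rewrite real_values_modn real_valuesM.
apply/eqP; have : (c b - 1) * (\sum_(0 <= n < q) c n) = 0.
  by rewrite mulrBl E mul1r subrr.
by move/eqP; rewrite mulf_eq0 subr_eq0 (negbTE cb).
Qed.

Lemma cpow_opp_real (n : nat) (b : R) : (0 < n)%N ->
  cpow_opp n b%:C%C = (n%:R `^ (- b))%:C%C.
Proof.
move=> n0; rewrite /cpow_opp -rmorphM -rmorphN /cexp /= cos0 sin0.
rewrite /powR gt_eqF ?ltr0n // mulNr.
by rewrite (_ : (1 +i* 0)%C = 1) ?mulr1.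
Qed.

Lemma cvg_real_complex (u : nat -> R) (l : R) : u @ \oo --> l ->
  (fun n => (u n)%:C%C : R[i]^o) @ \oo --> (l%:C%C : R[i]^o).
Proof.
move=> /cvgrPdist_lt ul; apply/cvgrPdist_lt => e e0.
(* A tolerance that is positive in the order of R[i] is real. *)
have er : e = (complex.Re e)%:C%C by rewrite RRe_real // gtr0_real.
have e0' : 0 < complex.Re e by rewrite -ltcR -er.
have := ul _ e0'; apply: filterS => n.
rewrite -rmorphB normc_def /= expr0n addr0 sqrtr_sqr => h.
by rewrite er ltcR.
Qed.

(** For b > 0 the series converges, so [limn] returns its sum and not the default value. *)
Lemma dirichlet_L_real (b : R) : 0 < b ->
  exists2 l : R, Lsum c b @ \oo --> l & dirichlet_L chi b%:C%C = l%:C%C.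
Proof.
move=> b0; have [l lc _] := Lsum_cvg quadratic_real_values b0.
exists l => //; rewrite /dirichlet_L; apply: (@cvg_lim (R[i]^o));
  first exact: norm_hausdorff.
have -> : (fun N : nat => \sum_(1 <= n < N.+1) chi n%:Z * cpow_opp n b%:C%C : R[i]^o) =
    (fun N => (Lsum c b N)%:C%C : R[i]^o); last exact: cvg_real_complex lc.
apply/funext => N; rewrite /Lsum rmorph_sum /=.
apply: eq_big_nat => n /andP[n0 _].
by rewrite real_valuesE cpow_opp_real // rmorphM.
Qed.

End RealDirichletCharacter.

(** * Deduction of the explicit constant *)

Theorem theorem18 (R : realType) (C : R) (hC : 0 < C)
    (l q : nat) (hl : (2 <= l)%N) (hq : (0 < q)%N)
    (hlq : expR (30 * l%:R ^+ 2) <= ln (q%:R : R))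
    (chi : int -> R[i]) (hchi : dirichlet_character q chi)
    (hnp : chi <> @principal_character R q) (hreal : real_character chi)
    (beta0 : R) (hbeta0 : exceptional_zero C q chi beta0) :
  beta0 <= 1 - 3200 * pi * (l%:R / (l%:R + 1)) ^+ 2
               / (Num.sqrt q%:R * ln q%:R ^+ 2).
Proof.
have hc := quadratic_real_values hq hchi hnp hreal.
(* l >= 2 gives log q >= e^120 > 120^6 / 720 > 10^9. *)
have l9 : 10 ^+ 9 <= ln (q%:R : R).
  apply: le_trans hlq; apply: (@le_trans _ _ (expR 120)).
    have x0 : 0 <= 120 :> R by [].
    apply: le_trans (expR_ge1Dxn 5 x0); rewrite (_ : 6`! = 720)%N //.
    lra.
  rewrite ler_expR; have : 2 * 2 <= (l%:R : R) ^+ 2 by rewrite expr2 ler_pM // ler_nat.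
  lra.
set L := ln _ in l9 *.
have L0 : 0 < L by apply: lt_le_trans l9; rewrite exprn_gt0.
have s1 : 1 <= Num.sqrt q%:R :> R.
  by rewrite -[leLHS]sqrtr1; apply: ler_wsqrtr; rewrite ler1n.
have s0 : 0 < Num.sqrt q%:R :> R by lra.
have D0 : 0 < Num.sqrt q%:R * L ^+ 2 by rewrite mulr_gt0 // exprn_gt0.
have k1 : (l%:R / (l%:R + 1)) ^+ 2 <= 1 :> R.
  have l0 : 0 < l%:R + 1 :> R by rewrite ltr_wpDl.
  rewrite -[leRHS](expr1n _ 2); apply: lerXn2r; rewrite ?nnegrE ?divr_ge0 ?(ltW l0) //.
  by rewrite ler_pdivrMr // mul1r lerDl.
(* The bound is 3200 * 4, from pi <= 4 and (l / (l + 1))^2 <= 1. *)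
have num : 3200 * pi * (l%:R / (l%:R + 1)) ^+ 2 <= 128 * 100 :> R.
  have pi4 : pi <= 4 :> R by have := pihalf_lt2 R; lra.
  have := ler_pM (pi_ge0 R) (sqr_ge0 _) pi4 k1.
  by move: pi ((l%:R / _) ^+ 2) => x y; lra.
have frac : 3200 * pi * (l%:R / (l%:R + 1)) ^+ 2 / (Num.sqrt q%:R * L ^+ 2) <=
    128 * 100 / (Num.sqrt q%:R * L ^+ 2).
  by rewrite ler_wpM2r // invr_ge0 ltW.
suff : beta0 <= 1 - 128 * 100 / (Num.sqrt q%:R * L ^+ 2) by lra.
(* For beta0 <= 0 the series diverges and [dirichlet_L] is a default value; there the bound holds
   because the subtracted fraction is at most 1. *)
have [b0|b0] := leP beta0 0; last first.
  apply: (real_zero_le hc) => //.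
  have [z zc zE] := dirichlet_L_real hq hchi hnp hreal b0.
  case: hbeta0 => + _; rewrite zE => /eqP; rewrite fmorph_eq0 => /eqP z0.
  by rewrite z0 in zc.
apply: le_trans b0 _; rewrite subr_ge0 ler_pdivrMr // mul1r.
have L1 : 128 * 100 <= L by lra.
have LL : L <= L ^+ 2 by rewrite expr2 ler_peMl //; lra.
by apply: le_trans (le_trans L1 LL) _; rewrite ler_peMl // sqr_ge0.
Qed.
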